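(* Let $K\subset\mathbb{R}^2$ be a strictly convex body with $C^1$ boundary. If $K$ floats in equilibrium in every position with perimetral density $\tfrac16$, then $K$ is a disk.
   Context: A convex body in $\mathbb{R}^2$ is a compact convex set with nonempty interior. Floating in equilibrium in every position: $K$ is regarded as having a uniform density $\rho\in(0,1)$ relative to water. For each unit vector $n$ (the upward direction), the waterline is the unique line orthogonal to $n$ such that the part of $K$ below it (the submerged part) has area $\rho\cdot\mathrm{area}(K)$ (Archimedes' law). $K$ is in equilibrium in that position if the line through the centroid of $K$ and the centroid of the submerged part is orthogonal to the waterline. $K$ floats in equilibrium in every position if this holds for every $n$. In that case every waterline cuts $\partial K$ into two arcs whose lengths are in a fixed ratio $\sigma:(1-\sigma)$, independent of the position; $\sigma$ is called the perimetral density. Known equivalence (Bracho–Montejano–Oliveros), which may be taken as the working definition: let $K$ be strictly convex with perimeter $P$ and let $\gamma:\mathbb{R}/P\mathbb{Z}\to\mathbb{R}^2$ be a $C^1$ arc-length parametrization of $\partial K$. Then $K$ floats in equilibrium in every position with perimetral density $\sigma=\frac1N$ if and only if there is a constant $\ell>0$, independent of $t$, such that for every $t$ the points $v_i(t)=\gamma\bigl(t+\frac{(i-1)P}{N}\bigr)$, $i=1,\dots,N$, are the vertices of an inscribed equilateral $N$-gon with side length $\ell$, i.e. $|v_{i+1}(t)-v_i(t)|=\ell$ for all $i$ (indices modulo $N$). *)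

(* Defs.v *)
From mathcomp Require Import all_boot all_order all_algebra.
From mathcomp Require Import all_classical all_reals all_analysis.

Set Implicit Arguments.
Unset Strict Implicit.
Unset Printing Implicit Defensive.

Import Order.TTheory GRing.Theory Num.Theory.
Import numFieldNormedType.Exports.

Local Open Scope classical_set_scope.
Local Open Scope ring_scope.

(* The library norm on ['rV[R]_n] is the sup norm; it induces the usual
   topology and derivatives, but lengths in the plane are Euclidean. *)
Definition enorm (R : realType) (x : 'rV[R]_2) : R :=
  Num.sqrt (\sum_(i < 2) x 0 i ^+ 2).

Definition boundary (T : topologicalType) (A : set T) : set T :=
  closure A `\` A°.

Definition convex_body (R : realType) (K : set 'rV[R]_2) : Prop :=
  [/\ compact K, convex_set K & K° !=set0].

Definition strictly_convex (R : realType) (K : set 'rV[R]_2) : Prop :=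
  forall (x y : 'rV[R]_2) (s : R), K x -> K y -> x != y ->
    0 < s < 1 -> K° (s *: x + (1 - s) *: y).

(* A map from R/PZ is encoded as a P-periodic map from R. *)
Definition C1_boundary_param (R : realType) (K : set 'rV[R]_2)
    (P : R) (gamma : R -> 'rV[R]_2) : Prop :=
  [/\ 0 < P,
      forall t, gamma (t + P) = gamma t,
      {in `[0, P[ &, injective gamma},
      range gamma = boundary K &
      (forall t, derivable gamma t 1) /\ continuous (derive1 gamma)].

Definition C1_boundary (R : realType) (K : set 'rV[R]_2) : Prop :=
  exists (P : R) (gamma : R -> 'rV[R]_2),
    C1_boundary_param K P gamma /\ forall t, derive1 gamma t != 0.

(* Since [gamma] is injective on a period and has unit speed, the period [P]
   is the perimeter of [K]. *)
Definition arclength_boundary_param (R : realType) (K : set 'rV[R]_2)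
    (P : R) (gamma : R -> 'rV[R]_2) : Prop :=
  C1_boundary_param K P gamma /\ forall t, enorm (derive1 gamma t) = 1.

(* The vertices v_1(t), ..., v_N(t), indexed from 0. *)
Definition inscribed_vertex (R : realType) (P : R) (gamma : R -> 'rV[R]_2)
    (N : nat) (t : R) (i : 'I_N) : 'rV[R]_2 :=
  gamma (t + i%:R * P / N%:R).

(* [K] floats in equilibrium in every position with perimetral density 1/N
   (N >= 2), in the form of Bracho, Montejano and Oliveros: the N points that
   cut the boundary into arcs of equal length, starting from an arbitrary
   boundary point, form an equilateral N-gon of constant side length.  The
   parametrization is unique up to translation and reversal of the parameter,
   under which the condition is invariant.  [ordS] is the successor modulo N. *)
Definition floats_in_every_position (R : realType) (K : set 'rV[R]_2)
    (N : nat) : Prop :=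
  exists (P : R) (gamma : R -> 'rV[R]_2),
    arclength_boundary_param K P gamma /\
    exists2 l : R, 0 < l &
      forall (t : R) (i : 'I_N),
        enorm (inscribed_vertex P gamma t (ordS i)
               - inscribed_vertex P gamma t i) = l.

Definition is_disk (R : realType) (K : set 'rV[R]_2) : Prop :=
  exists (c : 'rV[R]_2) (r : R),
    0 < r /\ K = [set x | enorm (x - c) <= r].

(* Main.v *)
Require Import Defs.
From mathcomp Require Import all_boot all_order all_algebra.
From mathcomp Require Import all_classical all_reals all_analysis.
From mathcomp Require Import ring lra.

Set Implicit Arguments.
Unset Strict Implicit.
Unset Printing Implicit Defensive.

Import Order.TTheory GRing.Theory Num.Theory.
Import numFieldNormedType.Exports.

Local Open Scope classical_set_scope.
Local Open Scope ring_scope.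

(* Write T for the tangent, u for the chord of the hexagon starting at a point
   and delta for the angle between them; the chord makes the same angle with the
   tangent at its other end, since its length is stationary.  The turning
   number of the convex boundary gives delta_0 + ... + delta_5 = pi, so the
   alternating sum of the directions of the sides is pi, and an equilateral
   hexagon with this property is centrally symmetric.  Hence delta has period
   P / 2, delta_0 + delta_1 + delta_2 = pi / 2 and, since the cosine of an
   exterior angle of the hexagon is sin delta_2, the angle satisfies the delay
   equation delta_0' = (2 / l) (sin delta_1 - sin delta_2).  An isoperimetric
   inequality applied to a closed curve built from delta shows that delta is
   the constant pi / 6, and then the centre of the hexagon does not move. *)

(** * Derivatives and monotonicity *)

Section Derivation.
Variable R : realType.
Implicit Types (f g : R -> R) (t a b : R).

Lemma is_derive_addf f g t a b : is_derive t 1 f a -> is_derive t 1 g b ->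
  is_derive t 1 (fun x => f x + g x) (a + b).
Proof. by move=> ? ?; apply: is_deriveD. Qed.

Lemma is_derive_oppf f t a : is_derive t 1 f a ->
  is_derive t 1 (fun x => - f x) (- a).
Proof. by move=> ?; apply: is_deriveN. Qed.

Lemma is_derive_mulf f g t a b : is_derive t 1 f a -> is_derive t 1 g b ->
  is_derive t 1 (fun x => f x * g x) (f t * b + g t * a).
Proof. by move=> ? ?; apply: is_deriveM. Qed.

Lemma is_derive_sqrf f t a : is_derive t 1 f a ->
  is_derive t 1 (fun x => f x ^+ 2) (2 * f t * a).
Proof.
move=> df; have := is_derive_mulf df df.
by under [X in is_derive _ _ X _]eq_fun do rewrite -expr2; congr is_derive; ring.
Qed.

Lemma is_derive_compf f g t a b :
  is_derive (g t) 1 f a -> is_derive t 1 g b ->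
  is_derive t 1 (fun x => f (g x)) (a * b).
Proof. by move=> ? ?; apply: is_derive1_comp. Qed.

Lemma is_derive_idf t : is_derive t (1 : R) (@idfun R) 1.
Proof. exact: is_derive_id. Qed.

Lemma is_derive_cstf (c : R) t : is_derive t (1 : R) (fun _ : R => c : R) 0.
Proof. exact: is_derive_cst. Qed.

Lemma is_derive_shiftf f t c a :
  is_derive (t + c) 1 f a -> is_derive t 1 (fun x => f (x + c)) a.
Proof.
move=> df; have dg : is_derive t 1 (fun x : R => x + c) (1 + 0).
  exact: (is_derive_addf (is_derive_idf t) (is_derive_cstf c t)).
by have := is_derive_compf (g := fun x => x + c) df dg; rewrite addr0 mulr1.
Qed.

End Derivation.

(** The derivative is an existential variable that the structure of the function fills in. The
    constant rule is a fallback and therefore comes last. *)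
Ltac derive_step :=
  match goal with
  | H : is_derive ?t _ ?f _ |- is_derive ?t _ ?f _ => exact: H
  | |- is_derive _ _ (@sin _) _ => notypeclasses refine (is_derive_sin _)
  | |- is_derive _ _ (@cos _) _ => notypeclasses refine (is_derive_cos _)
  | |- is_derive _ _ ( *%R ?c) _ =>
      notypeclasses refine (is_derive_mulf (is_derive_cstf c _) (is_derive_idf _))
  | |- is_derive _ _ -%R _ =>
      notypeclasses refine (is_derive_oppf (is_derive_idf _))
  | |- is_derive _ _ (fun x => x) _ => notypeclasses refine (is_derive_idf _)
  | |- is_derive _ _ (fun x => _ + _) _ =>
      notypeclasses refine (is_derive_addf _ _)
  | |- is_derive _ _ (fun x => - _) _ =>
      notypeclasses refine (is_derive_oppf _)
  | |- is_derive _ _ (fun x => _ * _) _ =>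
      notypeclasses refine (is_derive_mulf _ _)
  | |- is_derive _ _ (fun x => _ ^+ 2) _ =>
      notypeclasses refine (is_derive_sqrf _)
  | |- is_derive _ _ (fun x => sin _) _ =>
      notypeclasses refine (is_derive_compf (is_derive_sin _) _)
  | |- is_derive _ _ (fun x => cos _) _ =>
      notypeclasses refine (is_derive_compf (is_derive_cos _) _)
  | H : (forall t, is_derive t _ ?f _) |- is_derive _ _ ?f _ =>
      notypeclasses refine (H _)
  | H : is_derive ?t _ ?f _ |- is_derive ?t _ (fun x => ?f x) _ => exact: H
  | H : (forall t, is_derive t _ ?f _) |- is_derive _ _ (fun x => ?f (_ + _)) _ =>
      notypeclasses refine (is_derive_shiftf (H _))
  | H : (forall t, is_derive t _ ?f _) |- is_derive _ _ (fun x => ?f _) _ =>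
      notypeclasses refine (is_derive_compf (H _) _)
  | |- is_derive _ _ (fun x => _) _ =>
      notypeclasses refine (is_derive_cstf _ _)
  end.
Ltac derive_by :=
  notypeclasses refine (is_derive_eq _ _); [repeat derive_step|rewrite /=].

Section Monotonicity.
Variable R : realType.
Implicit Types (f df : R -> R) (a b c : R).

Lemma le_of_derive_ge0 f df a b : a <= b ->
  (forall t : R, a <= t <= b -> is_derive t 1 f (df t)) ->
  (forall t : R, a <= t <= b -> 0 <= df t) -> f a <= f b.
Proof.
move=> ab dfP df0.
have dfP' x : x \in `]a, b[ -> is_derive x 1 f (df x).
  by rewrite in_itv /= => /andP[ax xb]; apply: dfP; rewrite !ltW.
have [c cab E] : exists2 c, c \in `[a, b] & f b - f a = df c * (b - a).
  apply: MVT_segment => //; apply: derivable_within_continuous => x.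
  by rewrite in_itv /= => xab; case: (dfP x xab).
rewrite -subr_ge0 E mulr_ge0 ?subr_ge0// df0//.
Qed.

(** A nonincreasing function with equal end values is constant, so [c] is an interior maximum. This
    replaces the statement that a nonpositive derivative with zero integral vanishes. *)
Lemma derive_eq0_of_periodic f df a b c : a < c < b ->
  (forall t : R, a <= t <= b -> is_derive t 1 f (df t)) ->
  (forall t : R, a <= t <= b -> df t <= 0) -> f a = f b -> df c = 0.
Proof.
move=> /andP[ac cb] dfP df0 fab.
have mon x y : a <= x -> x <= y -> y <= b -> f y <= f x.
  move=> ax xy yb; rewrite -lerN2.
  apply: (@le_of_derive_ge0 (fun t => - f t) (fun t => - df t)) => // t /andP[xt ty].
    by apply: is_derive_oppf; apply: dfP; rewrite (le_trans ax)// (le_trans ty).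
  by rewrite oppr_ge0 df0// (le_trans ax)// (le_trans ty).
have H : is_derive c 1 f 0.
  apply: (@derive1_at_max _ f a b); first by rewrite ltW// (lt_trans ac).
  - by move=> t; rewrite in_itv /= => /andP[ta tb]; case: (dfP t _) => //; rewrite !ltW.
  - by rewrite in_itv /= ac.
  move=> t; rewrite in_itv /= => /andP[ta tb].
  apply: (@le_trans _ _ (f a)); first by apply: mon => //; exact: ltW.
  by rewrite fab; apply: mon => //; exact: ltW.
have [_ <-] := dfP c (introT andP (conj (ltW ac) (ltW cb))).
by case: H.
Qed.

End Monotonicity.

(** * Trigonometric estimates *)

Section Trigo.
Variable R : realType.
Implicit Types x y : R.

(** First of three Taylor bounds: the derivative of each difference is the difference of the
    preceding bound, starting from [cos t <= 1]. *)
Lemma sin_le_id x : 0 <= x -> sin x <= x.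
Proof.
have D (t : R) : is_derive t 1 (fun t : R => t - sin t) (1 - cos t) by derive_by; ring.
move=> x0; have := le_of_derive_ge0 x0 (fun t _ => D t).
rewrite sin0 subr0 subr_ge0; apply => t _.
by rewrite subr_ge0 cos_le1.
Qed.

Lemma cos_ge_quadratic x : 0 <= x -> 1 - x ^+ 2 / 2 <= cos x.
Proof.
have D (t : R) : is_derive t 1 (fun t : R => cos t - (1 - t ^+ 2 / 2)) (t - sin t).
  by derive_by; field.
move=> x0; have := le_of_derive_ge0 x0 (fun t _ => D t).
have -> : cos 0 - (1 - 0 ^+ 2 / 2) = 0 :> R by rewrite cos0; lra.
rewrite subr_ge0; apply => t /andP[t0 _].
by rewrite subr_ge0 sin_le_id.
Qed.

Lemma sin_ge_cubic x : 0 <= x -> x - x ^+ 3 / 6 <= sin x.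
Proof.
have D (t : R) : is_derive t 1 (fun t : R => sin t - (t - t * t ^+ 2 / 6))
    (cos t - (1 - t ^+ 2 / 2)).
  by derive_by; lra.
move=> x0; have := le_of_derive_ge0 x0 (fun t _ => D t).
have -> : sin 0 - (0 - 0 * 0 ^+ 2 / 6) = 0 :> R by rewrite sin0; lra.
rewrite exprS subr_ge0; apply => t /andP[t0 _].
by rewrite subr_ge0 cos_ge_quadratic.
Qed.

Lemma sin_pi6 : sin (pi / 6) = 1 / 2 :> R.
Proof.
set s := sin _.
have pi0 := @pi_gt0 R.
have s0 : 0 < s by apply: sin_gt0_pi; lra.
have : sin (pi / 6 + pi / 6 + pi / 6) = 1 :> R.
  by rewrite (_ : _ + _ = pi / 2) ?sin_pihalf//; lra.
rewrite !sinD !cosD -/s; have := sin2cos2 (pi / 6 : R); rewrite -/s.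
set c := cos _ => sc E.
(* The triple angle formula [3 s - 4 s ^ 3 = 1], factored. *)
have : (2 * s - 1) ^+ 2 * (s + 1) = 0.
  have -> : (2 * s - 1) ^+ 2 * (s + 1) = 1 - ((s * c + c * s) * c + (c * c - s * s) * s)
    + 3 * s * (c ^+ 2 - (1 - s ^+ 2)) by ring.
  rewrite E sc; ring.
move=> /eqP; rewrite mulf_eq0 sqrf_eq0 => /orP[] /eqP ?; lra.
Qed.

Lemma cos_pi6 : cos (pi / 6) = Num.sqrt 3 / 2 :> R.
Proof.
have pi0 := @pi_gt0 R.
have c0 : 0 < cos (pi / 6 : R) by apply: cos_gt0_pihalf; lra.
have := cos2sin2 (pi / 6 : R); rewrite sin_pi6 => c2.
have s3 : (Num.sqrt 3 : R) ^+ 2 = 3 by rewrite sqr_sqrtr.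
have s30 : 0 <= (Num.sqrt 3 : R) by [].
move: s3 s30 c0 c2; set c := cos _; set s := Num.sqrt 3 => s3 s30 c0 c2.
have : (c - s / 2) * (c + s / 2) = 0.
  have -> : (c - s / 2) * (c + s / 2) = c ^+ 2 - s ^+ 2 / 4 by field.
  by rewrite c2 s3; lra.
by move=> /eqP; rewrite mulf_eq0 => /orP[] /eqP ?; lra.
Qed.

(** Doubling the angle [pi / 12] gives [1 / 2 = 2 sin cos < 2 * pi / 12]. *)
Lemma pi_gt3 : 3 < pi :> R.
Proof.
have pi0 := @pi_gt0 R.
have : sin (pi / 12 + pi / 12) = 1 / 2 :> R by rewrite -sin_pi6; congr sin; lra.
rewrite sinD => E.
have h1 : sin (pi / 12) <= pi / 12 :> R by apply: sin_le_id; lra.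
have h2 : 0 < sin (pi / 12) :> R by apply: sin_gt0_pi; lra.
have h3 : cos (pi / 12) < 1 :> R.
  by rewrite -[ltRHS]cos0 ltr_cos ?in_itv /=; lra.
nra.
Qed.

Lemma pi_lt_315_100 : pi < 315 / 100 :> R.
Proof.
have pi0 := @pi_ge2 R.
rewrite ltNge; apply/negP => h.
(* Here [525 / 1000] is [315 / 600], where the cubic lower bound for the sine exceeds [1 / 2]. *)
have : sin (525 / 1000) <= sin (pi / 6) :> R.
  move: h; rewrite le_eqVlt => /predU1P[<-|h].
     by rewrite le_eqVlt; apply/orP; left; apply/eqP; congr sin; lra.
  by rewrite ltW// ltr_sin ?in_itv /=; have := @pihalf_lt2 R; lra.
rewrite sin_pi6.
have := @sin_ge_cubic (525 / 1000); lra.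
Qed.

Lemma sin_sub x y :
  sin x - sin y = 2 * (sin ((x - y) / 2) * cos ((x + y) / 2)).
Proof.
have -> : sin x = sin ((x + y) / 2 + (x - y) / 2) by congr sin; lra.
have -> : sin y = sin ((x + y) / 2 - (x - y) / 2) by congr sin; lra.
rewrite sinB sinD; ring.
Qed.

(** Both [(x - y) / 2] and [(x + y) / 2] are at most [pi / 4]. In the product formula [sin u / u] is
    at least 0.896 and the cosine at least 0.7, and 0.62 is below their product. *)
Lemma sin_slope_bounds x y : 0 <= y -> y <= x -> x + y <= pi / 2 ->
  62 / 100 * (x - y) <= sin x - sin y <= x - y.
Proof.
move=> y0 yx xy; rewrite sin_sub; set u := (x - y) / 2.
have -> : x - y = 2 * u by rewrite /u; lra.
have pi0 := pi_gt3; have pi1 := @pi_lt_315_100.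
have c1 := cos_le1 ((x + y) / 2).
have c2 : 7 / 10 <= cos ((x + y) / 2).
  apply: (@le_trans _ _ (cos (pi / 4))); last first.
    have := xy; rewrite le_eqVlt => /predU1P[->|h].
      by rewrite le_eqVlt; apply/orP; left; apply/eqP; congr cos; lra.
    by rewrite ltW// ltr_cos ?in_itv /=; lra.
  have c0 : 0 <= cos (pi / 4 : R) by rewrite ltW// cos_gt0_pihalf//; lra.
  have : cos (pi / 4 + pi / 4) = 0 :> R by rewrite -(@cos_pihalf R); congr cos; lra.
  rewrite cosD; have := cos2Dsin2 (pi / 4 : R).
  nra.
have u0 : 0 <= u by rewrite /u; lra.
have u1 : u <= 315 / 400 by rewrite /u; lra.
have := sin_le_id u0; have := sin_ge_cubic u0.
have -> : u - u ^+ 3 / 6 = u * (1 - u ^+ 2 / 6) by field.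
have : 896 / 1000 <= 1 - u ^+ 2 / 6 by nra.
move: (sin u) (cos _) c1 c2 (u ^+ 2) => s c c1 c2 v v1 s1 s2.
have s3 : 896 / 1000 * u <= s by nra.
apply/andP; split; nra.
Qed.

End Trigo.

(** * Rigidity of the delay equation *)

Section Rigidity.
Variable R : realType.
Implicit Types (x y k t : R) (d : R -> R).

Lemma cos_2pi3 : cos (2 * pi / 3) = - (1 / 2) :> R.
Proof.
by rewrite (_ : 2 * pi / 3 = pi / 6 + pi / 2) ?cosDpihalf ?sin_pi6//; lra.
Qed.

Lemma sin_2pi3 : sin (2 * pi / 3) = Num.sqrt 3 / 2 :> R.
Proof.
by rewrite (_ : 2 * pi / 3 = pi / 6 + pi / 2) ?sinDpihalf ?cos_pi6//; lra.
Qed.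

Lemma sqr_sqrt3 : Num.sqrt 3 ^+ 2 = 3 :> R.
Proof. by rewrite sqr_sqrtr. Qed.

(** For [x != y], [K] times the slope of the sine lies between [3.4 * 0.62 > 2.1] and 4, hence
    strictly between the roots [2 pi / 3] and [2 pi / 3 + 2] of the quadratic form. *)
Lemma slope_form_le0 k x y : 2 <= k -> k * Num.sqrt 3 <= 4 -> 0 <= x -> 0 <= y ->
    x + y <= pi / 2 ->
  let K := k * Num.sqrt 3 in let f := (K * (sin x - sin y) - 2 * pi / 3 * (x - y)) *
    (K * (sin x - sin y) - (2 * pi / 3 + 2) * (x - y)) in
  f <= 0 /\ (f = 0 -> x = y).
Proof.
move=> k2 k4 x0 y0 xy K f.
have pi0 := @pi_gt3 R; have pi1 := @pi_lt_315_100 R.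
have s3 : 17 / 10 <= Num.sqrt 3 :> R.
  by have := sqr_sqrt3; have : 0 <= Num.sqrt 3 :> R by []; nra.
have K1 : 34 / 10 <= K by rewrite /K; nra.
have key D S : 0 < D -> 62 / 100 * D <= S <= D ->
    (K * S - 2 * pi / 3 * D) * (K * S - (2 * pi / 3 + 2) * D) < 0.
  move=> D0 /andP[S1 S2]; rewrite pmulr_rlt0.
    by have := k4; rewrite -/K => k4'; nra.
  by nra.
have [xlty|yltx|exy] := ltgtP x y; last by rewrite /f exy !subrr !mulr0 subrr mulr0.
- have := @key (y - x) (sin y - sin x); rewrite subr_gt0 => /(_ xlty).
  move=> /(_ (sin_slope_bounds x0 (ltW xlty) _)); rewrite addrC => /(_ xy).
  set g := (X in X < 0); have -> : g = f by rewrite /f /g; ring.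
  by move=> f0; split => [|fE]; [exact: ltW|move: f0; rewrite fE ltxx].
- have := @key (x - y) (sin x - sin y); rewrite subr_gt0 => /(_ yltx).
  move=> /(_ (sin_slope_bounds y0 (ltW yltx) xy)) f0.
  by split => [|fE]; [exact: ltW|move: f0; rewrite -/f fE ltxx].
Qed.

(* In the moving frame below the curve [(p, q)] is closed of period 1, and
   [p' ^ 2 + q' ^ 2 - 2 (p' q - p q')] is a combination of the forms of
   [slope_form_le0], hence nonpositive.  On the other hand its integral is
   nonnegative by a weak form of the isoperimetric inequality: with
   [qh := q - q 0] and [r := 2 tan (2 t - 1)], so that [r' = 4 + r ^ 2],
   it equals [(p' - 2 qh)^2 + (q' + r qh)^2] plus the derivative of
   [2 p q - 4 q(0) p - r qh ^ 2]. *)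
Lemma cyclic_delay_rigidity d k : 2 <= k -> k * Num.sqrt 3 <= 4 ->
    (forall t, 0 < d t) -> (forall t, d t + d (t + 1) + d (t + 2) = pi / 2) ->
    (forall t, is_derive t 1 d (k * (sin (d (t + 1)) - sin (d (t + 2))))) ->
  forall t, d t = pi / 6.
Proof.
move=> k2 k4 d0 dsum dd.
(* The equation is invariant under translation, so one interior point of [0, 1] suffices. *)
suff half d' : (forall t, 0 < d' t) ->
    (forall t, d' t + d' (t + 1) + d' (t + 2) = pi / 2) ->
    (forall t, is_derive t 1 d' (k * (sin (d' (t + 1)) - sin (d' (t + 2))))) ->
    d' (1 / 2) = pi / 6.
  move=> t; have [c ->] : exists c, t = 1 / 2 + c by exists (t - 1 / 2); lra.
  apply: (half (fun u => d (u + c))) => u //.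
  - by rewrite -(dsum (u + c)); congr (_ + _ + _); congr d; ring.
  - by apply: is_derive_shiftf; rewrite ![_ + _ + c]addrAC.
move: d' {d d0 dsum dd} => d d0 dsum dd.
have shift11 t : t + 1 + 1 = t + 2 by ring.
have shift12 t : t + 1 + 2 = t + 3 by ring.
have shift21 t : t + 2 + 1 = t + 3 by ring.
have shift22 t : t + 2 + 2 = t + 1 + 3 by ring.
have per t : d (t + 3) = d t.
  by have := dsum t; have := dsum (t + 1); rewrite shift11 shift12; lra.
have dd1 (t : R) : is_derive t 1 (fun t => d (t + 1)) (k * (sin (d (t + 2)) - sin (d t))).
  by apply: is_derive_shiftf; apply: is_derive_eq (dd _) _; rewrite shift11 shift12 per.
have dd2 (t : R) : is_derive t 1 (fun t => d (t + 2)) (k * (sin (d t) - sin (d (t + 1)))).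
  by apply: is_derive_shiftf; apply: is_derive_eq (dd _) _; rewrite shift21 shift22 !per.
pose w : R := 2 * pi / 3; pose s3 : R := Num.sqrt 3.
(* [A f + i B f] is a discrete Fourier component of [f t], [f (t + 1)], [f (t + 2)]. For [f] of
   period 3 a unit shift multiplies it by [exp (i w)], so [p - i q = exp (- i w t) (A d + i B d)]
   has period 1. *)
pose A (f : R -> R) t := f t - (f (t + 1) + f (t + 2)) / 2.
pose B (f : R -> R) t := s3 / 2 * (f (t + 2) - f (t + 1)).
pose S t := sin (d t).
pose p t := cos (w * t) * A d t + sin (w * t) * B d t.
pose q t := sin (w * t) * A d t - cos (w * t) * B d t.
pose K := k * s3.
pose P' t := - K * (cos (w * t) * B S t - sin (w * t) * A S t) - w * q t.
pose Q' t := - K * (sin (w * t) * B S t + cos (w * t) * A S t) + w * p t.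
have s32 : s3 * s3 = 3 by rewrite -expr2 sqr_sqrt3.
have dA (t : R) : is_derive t 1 (A d) (- K * B S t).
  rewrite /A; derive_by; rewrite mulNr.
  have -> : K * B S t = k * (s3 * s3) / 2 * (S (t + 2) - S (t + 1)).
    by rewrite /K /B; field.
  by rewrite s32 /S; field.
have dB (t : R) : is_derive t 1 (B d) (K * A S t).
  by rewrite /B; derive_by; rewrite /K /A /S; field.
have dp (t : R) : is_derive t 1 p (P' t).
  by rewrite /p; derive_by; rewrite /P' /q; ring.
have dq (t : R) : is_derive t 1 q (Q' t).
  by rewrite /q; derive_by; rewrite /Q' /p; ring.
have per01 (f : R -> R) : f 3 = f 0 ->
   A f 1 = - (A f 0 + s3 * B f 0) / 2 /\ B f 1 = (s3 * A f 0 - B f 0) / 2.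
  move=> f3; have -> : s3 * B f 0 = s3 * s3 / 2 * (f 2 - f 1) by rewrite /B !add0r; ring.
  rewrite /A /B !add0r s32.
  have -> : 1 + 1 = 2 :> R by ring.
  have -> : 1 + 2 = 3 :> R by ring.
  by rewrite f3; split; field.
have [A1 B1] := per01 d (etrans (congr1 d (esym (add0r 3))) (per 0)).
have p10 : p 1 = p 0.
  rewrite /p A1 B1 mulr1 mulr0 sin_2pi3 cos_2pi3 cos0 sin0 -/s3.
  by apply/eqP; rewrite -subr_eq0; apply/eqP; transitivity ((s3 * s3 - 3) * A d 0 / 4);
    [field|rewrite s32; field].
have q10 : q 1 = q 0.
  rewrite /q A1 B1 mulr1 mulr0 sin_2pi3 cos_2pi3 cos0 sin0 -/s3.
  by apply/eqP; rewrite -subr_eq0; apply/eqP; transitivity ((3 - s3 * s3) * B d 0 / 4);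
    [field|rewrite s32; field].
pose r t : R := 2 * tan (2 * t - 1).
have dr (t : R) : 0 <= t <= 1 -> is_derive t 1 r (4 + r t ^+ 2).
  (* For [t] in [0, 1] the argument [2 * t - 1] stays in [-1, 1], where the tangent is smooth. *)
  move=> t01; have pi3 := @pi_gt3 R.
  have c0 : cos (2 * t - 1) != 0 by rewrite gt_eqF// cos_gt0_pihalf//; lra.
  have dt : is_derive t 1 (fun t => tan (2 * t - 1)) ((cos (2 * t - 1)) ^- 2 * 2).
    notypeclasses refine (is_derive_eq (is_derive_compf (g := fun t => 2 * t - 1)
      (is_derive_tan c0) _) _); [repeat derive_step|].
    by rewrite /=; congr (_ * _); ring.
  by rewrite /r; derive_by; rewrite cos2_tan2//; ring.
pose G t := 2 * (p t * q t) - 4 * q 0 * p t - r t * (q t - q 0) ^+ 2.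
pose N t := P' t ^+ 2 + Q' t ^+ 2 - 2 * (P' t * q t) + 2 * (p t * Q' t).
pose sq t := (P' t - 2 * (q t - q 0)) ^+ 2 + (Q' t + r t * (q t - q 0)) ^+ 2.
have dG (t : R) : 0 <= t <= 1 -> is_derive t 1 G (N t - sq t).
  move=> t01; have drt := dr t t01; rewrite /G; derive_by.
  by rewrite /N /sq; ring.
pose F x y := (K * (sin x - sin y) - w * (x - y)) *
    (K * (sin x - sin y) - (w + 2) * (x - y)).
(* The rotation by [w * t] drops out, and Parseval's identity for three points turns the forms in
   [A] and [B] into forms in pairwise differences. *)
have NE t : N t =
    (F (d t) (d (t + 1)) + F (d t) (d (t + 2)) + F (d (t + 1)) (d (t + 2))) / 2.
  have -> : N t = (cos (w * t) ^+ 2 + sin (w * t) ^+ 2) *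
     ((K * A S t - w * A d t) * (K * A S t - (w + 2) * A d t) +
      (K * B S t - w * B d t) * (K * B S t - (w + 2) * B d t)).
    by rewrite /N /P' /Q' /p /q; ring.
  rewrite cos2Dsin2 mul1r.
  have -> : (K * B S t - w * B d t) * (K * B S t - (w + 2) * B d t) =
     s3 * s3 / 4 * ((K * (S (t + 2) - S (t + 1)) - w * (d (t + 2) - d (t + 1))) *
      (K * (S (t + 2) - S (t + 1)) - (w + 2) * (d (t + 2) - d (t + 1)))).
    by rewrite /B; field.
  by rewrite s32 /A /F /S; field.
have FP (t x y z : R) : 0 < x -> 0 < y -> 0 < z -> x + y + z = pi / 2 ->
    F x y <= 0 /\ (F x y = 0 -> x = y).
  by move=> x0 y0 z0 xyz; apply: (slope_form_le0 k2 k4); lra.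
have Fd t : [/\ F (d t) (d (t + 1)) <= 0, F (d t) (d (t + 2)) <= 0 &
    F (d (t + 1)) (d (t + 2)) <= 0].
  by split; [have [] := FP t _ _ _ (d0 t) (d0 (t + 1)) (d0 (t + 2))
    |have [] := FP t _ _ _ (d0 t) (d0 (t + 2)) (d0 (t + 1))
    |have [] := FP t _ _ _ (d0 (t + 1)) (d0 (t + 2)) (d0 t)];
   have := dsum t; lra.
have sq0 t : 0 <= sq t by rewrite addr_ge0 ?sqr_ge0.
have Nle0 t : N t - sq t <= 0.
  by rewrite NE; have [] := Fd t; have := sq0 t; lra.
(* [G] is nonincreasing on [0, 1] with equal end values: [p] and [q] agree at 0 and 1, and the
   factor of [r] vanishes there. So every nonpositive summand of the derivative is zero at
   [1 / 2]. *)
have NE0 : N (1 / 2) - sq (1 / 2) = 0.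
  apply: (derive_eq0_of_periodic (f := G) (df := fun t => N t - sq t)
    (a := 0) (b := 1)) => //.
    by lra.
  by rewrite /G p10 q10 subrr !expr2 !mulr0.
set h : R := 1 / 2 in NE0 *.
have := NE h; have [F1 F2 F3] := Fd h; have := sq0 h => sqh NEh.
have [_ e1] := FP h _ _ _ (d0 h) (d0 (h + 1)) (d0 (h + 2)) (dsum h).
have [|_ e2] := FP h _ _ _ (d0 h) (d0 (h + 2)) (d0 (h + 1)).
  by have := dsum h; lra.
have /e1 E1 : F (d h) (d (h + 1)) = 0 by lra.
have /e2 E2 : F (d h) (d (h + 2)) = 0 by lra.
by have := dsum h; lra.
Qed.
End Rigidity.

(** * Angles in the plane *)

Section PlaneAngle.
Variable R : realType.
Implicit Types (a b r : R) (u v w : R * R).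

Definition dot u v := u.1 * v.1 + u.2 * v.2.
Definition det u v := u.1 * v.2 - u.2 * v.1.
Definition rotv a v := (cos a * v.1 - sin a * v.2, sin a * v.1 + cos a * v.2).
(** By Lagrange's identity the root is the product of the two lengths. The angle is unoriented, but
    equals the oriented one when [det u v] is positive. *)
Definition ang u v := acos (dot u v / Num.sqrt (dot u v ^+ 2 + det u v ^+ 2)).

Lemma sqr_dotDdet u v : dot u v ^+ 2 + det u v ^+ 2 = dot u u * dot v v.
Proof. by rewrite /dot /det; ring. Qed.

Lemma dot_rotv a b v : dot (rotv a v) (rotv b v) = cos (b - a) * dot v v.
Proof. by rewrite cosB /dot /rotv /=; ring. Qed.

Lemma rotvD a b v : rotv (a + b) v = rotv a (rotv b v).
Proof. by rewrite /rotv cosD sinD /=; congr (_, _); ring. Qed.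

Lemma polar_inj r a r' b : 0 < r -> 0 < r' ->
  r * cos a = r' * cos b -> r * sin a = r' * sin b ->
  cos a = cos b /\ sin a = sin b.
Proof.
move=> r0 r'0 ec es.
have : r ^+ 2 = r' ^+ 2.
  have := cos2Dsin2 a; have := cos2Dsin2 b => hb ha.
  have -> : r ^+ 2 = (r * cos a) ^+ 2 + (r * sin a) ^+ 2 by rewrite -[LHS]mulr1 -ha; ring.
  by rewrite ec es -[RHS]mulr1 -hb; ring.
move=> /eqP; rewrite eqf_sqr => /orP[] /eqP er; last by lra.
have rn0 : r' != 0 by rewrite gt_eqF.
by split; [move: ec|move: es]; rewrite er; apply: mulfI.
Qed.

Lemma angP u v : 0 < det u v -> let r := Num.sqrt (dot u u * dot v v) in
  [/\ 0 < r, 0 < ang u v, ang u v < pi, dot u v = r * cos (ang u v) &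
      det u v = r * sin (ang u v)].
Proof.
move=> uv r.
have d0 : 0 < dot u v ^+ 2 + det u v ^+ 2 by rewrite ltr_wpDl ?sqr_ge0// exprn_gt0.
rewrite /ang sqr_dotDdet -/r.
have r0 : 0 < r by rewrite sqrtr_gt0 -sqr_dotDdet.
have r2 : r ^+ 2 = dot u v ^+ 2 + det u v ^+ 2 by rewrite sqr_sqrtr -sqr_dotDdet// ltW.
have x1 : (dot u v / r) ^+ 2 = 1 - (det u v / r) ^+ 2.
  have rn0 : r != 0 by rewrite gt_eqF.
  rewrite !expr_div_n r2; field.
  by rewrite gt_eqF.
have s0 : 0 < det u v / r by rewrite divr_gt0.
have xb : -1 < dot u v / r < 1 by nra.
have xb' : -1 <= dot u v / r <= 1 by lra.
split => //.
- by rewrite acos_gt0//; lra.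
- by rewrite acos_ltpi//; lra.
- by rewrite acosK ?in_itv//= mulrC divfK// gt_eqF.
- rewrite sin_acos// x1 opprB addrC subrK sqrtr_sqr gtr0_norm//.
  by rewrite mulrC divfK// gt_eqF.
Qed.

Lemma ang_uniq u v r a : 0 < a < pi -> 0 < r ->
  dot u v = r * cos a -> det u v = r * sin a -> ang u v = a.
Proof.
move=> a0 r0 e1 e2.
have uv : 0 < det u v by rewrite e2 mulr_gt0// sin_gt0_pi.
have [q0 h1 h2 h3 h4] := angP uv.
have [+ _] := polar_inj q0 r0 (etrans (esym h3) e1) (etrans (esym h4) e2).
by apply: cos_inj; rewrite in_itv /=; lra.
Qed.

(** The sum is an argument of [w] relative to [u] by the addition formulas. It stays below [pi],
    since otherwise its sine, and with it [det u w], would be nonpositive. *)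
Lemma ang_add u v w : 0 < det u v -> 0 < det v w -> 0 < det u w ->
  ang u w = ang u v + ang v w.
Proof.
move=> uv vw uw.
have [r0 a0 a1 a2 a3] := angP uv; have [q0 b0 b1 b2 b3] := angP vw.
set a := ang u v in a0 a1 a2 a3 *; set b := ang v w in b0 b1 b2 b3 *.
set r := Num.sqrt _ in r0 a2 a3; set q := Num.sqrt _ in q0 b2 b3.
have n0 : 0 < dot v v.
  rewrite lt_neqAle eq_sym addr_ge0 ?sqr_ge0// andbT; apply/negP => /eqP v0.
  by have := sqr_dotDdet u v; rewrite v0 mulr0; nra.
have e1 : dot u w = r * q / dot v v * cos (a + b).
  apply: (mulfI (lt0r_neq0 n0)).
  transitivity (dot u v * dot v w - det u v * det v w); first by rewrite /dot /det; ring.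
  by rewrite a2 a3 b2 b3 cosD; field; rewrite gt_eqF.
have e2 : det u w = r * q / dot v v * sin (a + b).
  apply: (mulfI (lt0r_neq0 n0)).
  transitivity (det u v * dot v w + dot u v * det v w); first by rewrite /dot /det; ring.
  by rewrite a2 a3 b2 b3 sinD; field; rewrite gt_eqF.
have m0 : 0 < r * q / dot v v by rewrite divr_gt0// mulr_gt0.
apply: (ang_uniq _ m0 e1 e2).
rewrite addr_gt0//= ltNge; apply/negP => h.
have : 0 <= sin (a + b - pi) by apply: sin_ge0_pi; lra.
have -> : sin (a + b - pi) = - sin (a + b).
  by rewrite -[in RHS](subrK pi (a + b)) sinDpi opprK.
by move: uw; rewrite e2 pmulr_rgt0//; lra.
Qed.

Lemma rotv_ang u v : 0 < det u v -> let n := Num.sqrt (dot u u * dot v v) in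
  (dot u u * v.1 = n * (rotv (ang u v) u).1) /\
  (dot u u * v.2 = n * (rotv (ang u v) u).2).
Proof.
move=> /angP[_ _ _ e1 e2] n; rewrite /= !mulrBr !mulrDr !mulrA -e1 -e2.
by split; rewrite /dot /det; ring.
Qed.

(* For unit complex numbers [z_i = exp (i phi_i)] with zero sum and
   [z_1 z_3 z_5 = - z_0 z_2 z_4], the monic cubics with roots [z_0, z_2, z_4] and
   [- z_1, - z_3, - z_5] coincide; evaluate at [- z_1]. *)
Lemma alternating_hexagon p0 p1 p2 p3 p4 p5 :
  cos p0 + cos p1 + cos p2 + cos p3 + cos p4 + cos p5 = 0 ->
  sin p0 + sin p1 + sin p2 + sin p3 + sin p4 + sin p5 = 0 ->
  p1 + p3 + p5 = p0 + p2 + p4 + pi ->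
  cos ((p1 - p0) / 2) * cos ((p2 - p1) / 2) * cos ((p4 - p1) / 2) = 0 :> R.
Proof.
move=> ec es alt.
(* Rotating by [m] makes [p3 + m] and [p5 + m] supplementary, so their cosines cancel. The other
   four cosines sum to four times the required product. *)
pose m := p1 / 2 - (p0 + p2 + p4) / 2.
have e3 : cos (p3 + m) + cos (p5 + m) = 0.
  have -> : p5 + m = - (p3 + m) + pi by rewrite /m; lra.
  by rewrite cosDpi cosN subrr.
have e : cos (p0 + m) + cos (p1 + m) + cos (p2 + m) + cos (p4 + m) = 0.
  have : (cos p0 + cos p1 + cos p2 + cos p3 + cos p4 + cos p5) * cos m -
         (sin p0 + sin p1 + sin p2 + sin p3 + sin p4 + sin p5) * sin m = 0.
    by rewrite ec es !mul0r subrr.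
  by move=> H; rewrite -[RHS]H -[LHS]addr0 -[X in _ + X = _]e3 !cosD; ring.
apply: (mulfI (lt0r_neq0 (_ : 0 < 4 :> R))) => //.
rewrite mulr0 -[RHS]e.
set A := (p1 - p0) / 2; set B := (p2 - p1) / 2; set C := (p4 - p1) / 2.
have -> : cos (p0 + m) = cos (A + B + C).
  by rewrite -cosN; congr cos; rewrite /m /A /B /C; lra.
have -> : p1 + m = A - B - C by rewrite /m /A /B /C; lra.
have -> : p2 + m = A + B - C by rewrite /m /A /B /C; lra.
have -> : p4 + m = A - B + C by rewrite /m /A /B /C; lra.
by rewrite !(cosD, sinD, cosN, sinN); ring.
Qed.

End PlaneAngle.

(** * Equilateral hexagons in a convex curve *)

Section Curve.
Variable R : realType.
Implicit Types (a b c t : R).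

Lemma derive_right_ge0 (f : R -> R) a b l : a < b -> is_derive a 1 f l -> f a = 0 ->
  (forall t, a < t < b -> 0 <= f t) -> 0 <= l.
Proof.
move=> ab [df <-] fa0 f0; rewrite ['D_1 f a]cvg_at_rightE; last exact: df.
apply: limr_ge.
  rewrite -(cvg_at_rightE (fun h : R => h^-1 *: ((f \o shift a) _ - f a))) //.
  apply: cvg_trans df; apply: cvg_app.
  by move=> A [e egt0 Ae]; exists e => // x xe xgt0; apply: Ae => //; exact/lt0r_neq0.
near=> h.
have h0 : 0 < h by near: h; exact: nbhs_right_gt.
apply: mulr_ge0; first by rewrite invr_ge0 ltW.
rewrite fa0 subr0 /= [h%:A]mulr1 f0// ltrDr h0 /= -ltrBrDr.
by near: h; apply: nbhs_right_lt; rewrite subr_gt0.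
Unshelve. all: by end_near. Qed.

(** * Tangents and turning of a closed strictly convex curve of period 6 *)

Variables X Y U V : R -> R.
Hypothesis dX : forall t, is_derive t 1 X (U t).
Hypothesis dY : forall t, is_derive t 1 Y (V t).
Hypothesis X6 : forall t, X (t + 6) = X t.
Hypothesis Y6 : forall t, Y (t + 6) = Y t.
Hypothesis unit_speed : forall t, U t ^+ 2 + V t ^+ 2 = 1.

Let g t : R * R := (X t, Y t).
Let T t : R * R := (U t, V t).

Hypothesis convex : forall a b c, a < b -> b < c -> c < a + 6 ->
  0 < det (g b - g a) (g c - g a).

Let dotTT t : dot (T t) (T t) = 1.
Proof. by rewrite -(unit_speed t) /dot /= !expr2. Qed.

Let mulT1 t (x : R) : x * dot (T t) (T t) = x.
Proof. by rewrite dotTT mulr1. Qed.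

Let g6 t : g (t + 6) = g t.
Proof. by rewrite /g X6 Y6. Qed.

Let T6 t : T (t + 6) = T t.
Proof.
have eqf (f : R -> R) l l' : is_derive t 1 f l -> is_derive t 1 f l' -> l = l'.
  by move=> [_ <-] [_ <-].
rewrite /T; congr (_, _).
  apply: (eqf X) => //; have := is_derive_shiftf (dX (t + 6)).
  by congr is_derive; apply: funext.
apply: (eqf Y) => //; have := is_derive_shiftf (dY (t + 6)).
by congr is_derive; apply: funext.
Qed.

(** The limit of [convex] gives only the weak inequality. In case of equality the chord to [c] is
    parallel to [T a]: a later point [d] forces it to point forward, an earlier point [b] forbids
    this. *)
Lemma tangent_det_gt0 a c : a < c -> c < a + 6 -> 0 < det (T a) (g c - g a).
Proof.
move=> ac ca.
have ge0 b : a < b -> b < a + 6 -> 0 <= det (T a) (g b - g a).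
  move=> ab ba.
  pose f s := (X s - X a) * (Y b - Y a) - (Y s - Y a) * (X b - X a).
  have df : is_derive a 1 f (det (T a) (g b - g a)).
    by rewrite /f; derive_by; rewrite /det /T /g /=; ring.
  apply: (derive_right_ge0 ab df); first by rewrite /f !subrr !mul0r subrr.
  by move=> s /andP[sa sb]; apply: ltW; exact: convex.
pose b := (a + c) / 2; pose d := (c + (a + 6)) / 2.
have ab : a < b by rewrite /b; lra.
have bc : b < c by rewrite /b; lra.
have cd : c < d by rewrite /d; lra.
have da : d < a + 6 by rewrite /d; lra.
have := ge0 _ ac ca; rewrite le_eqVlt => /predU1P[e|//].
have h1 := convex ab bc ca; have h2 := convex ac cd da.
have h3 := ge0 _ ab (lt_trans bc ca); have h4 := ge0 _ (lt_trans ac cd) da.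
have := dotTT a => n1.
have e1 : det (g b - g a) (g c - g a) =
    dot (T a) (g b - g a) * det (T a) (g c - g a) -
    det (T a) (g b - g a) * dot (T a) (g c - g a).
  by rewrite -[LHS]mul1r -n1 /dot /det /=; ring.
have e2 : det (g c - g a) (g d - g a) =
    dot (T a) (g c - g a) * det (T a) (g d - g a) -
    dot (T a) (g d - g a) * det (T a) (g c - g a).
  by rewrite -[LHS]mul1r -n1 /dot /det /=; ring.
rewrite -e mulr0 sub0r in e1; rewrite -e mulr0 subr0 in e2.
rewrite e1 oppr_gt0 in h1; rewrite e2 in h2.
have l0 : 0 < dot (T a) (g c - g a).
  by rewrite ltNge; apply/negP => l0; move: h2; rewrite ltNge mulr_le0_ge0.
by move: h1; rewrite ltNge mulr_ge0// ltW.
Qed.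

Lemma det_tangent_gt0 a c : a < c -> c < a + 6 -> 0 < det (g c - g a) (T c).
Proof.
move=> ac ca; have := @tangent_det_gt0 c (a + 6); rewrite g6 => /(_ ca).
have -> : a + 6 < c + 6 by lra.
by move=> /(_ isT); congr (0 < _); rewrite /det /=; ring.
Qed.

(* An additive lift to ]0, 2 pi[ of the angle between two tangents. *)
Let turn a b := ang (T a) (g b - g a) + ang (g b - g a) (T b).

(** The angle between the chords [a b] and [b c] is split in two ways, by the tangent at [b] and by
    the chord [a c]. *)
Lemma turnD a b c : a < b -> b < c -> c < a + 6 -> turn a c = turn a b + turn b c.
Proof.
move=> ab bc ca; have ac := lt_trans ab bc.
have ba := lt_trans bc ca.
have cb : c < b + 6 by lra.
have abc := convex ab bc ca.
have dist1 : det (g b - g a) (g c - g b) = det (g b - g a) (g c - g a).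
  by rewrite /det /=; ring.
have dist2 : det (g c - g a) (g c - g b) = det (g b - g a) (g c - g a).
  by rewrite /det /=; ring.
rewrite /turn.
rewrite (@ang_add _ (T a) (g b - g a) (g c - g a)) ?tangent_det_gt0//.
rewrite (@ang_add _ (g c - g a) (g c - g b) (T c)) ?det_tangent_gt0 ?dist2//.
have := @ang_add _ (g b - g a) (T b) (g c - g b).
rewrite dist1 => /(_ (det_tangent_gt0 ab ba) (tangent_det_gt0 bc cb) abc) e1.
have := @ang_add _ (g b - g a) (g c - g a) (g c - g b).
rewrite dist1 dist2 => /(_ abc abc abc) e2.
lra.
Qed.

Lemma rotv_turn a b : a < b -> b < a + 6 -> T b = rotv (turn a b) (T a).
Proof.
move=> ab ba; have h1 := tangent_det_gt0 ab ba; have h2 := det_tangent_gt0 ab ba.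
have [e1 e2] := rotv_ang h1; have [e3 e4] := rotv_ang h2.
have n0 : 0 < dot (g b - g a) (g b - g a).
  rewrite lt_neqAle eq_sym addr_ge0 ?sqr_ge0// andbT; apply/negP => /eqP v0.
  by have := sqr_dotDdet (T a) (g b - g a); rewrite v0 mulr0; nra.
rewrite dotTT !mul1r in e1 e2; rewrite dotTT mulr1 in e3 e4.
have r1 x (v : R * R) : (rotv x v).1 = cos x * v.1 - sin x * v.2 by [].
have r2 x (v : R * R) : (rotv x v).2 = sin x * v.1 + cos x * v.2 by [].
set w := g b - g a in h1 h2 n0 e1 e2 e3 e4 *.
set n := dot w w in n0 e1 e2 e3 e4; set s := Num.sqrt n in e1 e2 e3 e4.
have s2 : s * s = n by rewrite -expr2 sqr_sqrtr// ltW.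
rewrite /turn addrC rotvD; set al := ang _ _ in e3 e4 *; set be := ang _ _ in e1 e2 *.
apply: injective_projections; apply: (mulfI (lt0r_neq0 n0)).
  by rewrite e3 !(r1, r2) e1 e2 -s2 !(r1, r2); ring.
by rewrite e4 !(r1, r2) e1 e2 -s2 !(r1, r2); ring.
Qed.

(** * Chords of constant length and the hexagon they form *)

Variable l : R.
Hypothesis l_gt0 : 0 < l.
Hypothesis side : forall t, (X (t + 1) - X t) ^+ 2 + (Y (t + 1) - Y t) ^+ 2 = l ^+ 2.

Let u t := g (t + 1) - g t.
Let de t := ang (T t) (u t).

Let dotuu t : dot (u t) (u t) = l * l.
Proof. by rewrite -expr2 -(side t) /dot /u /g /= !expr2. Qed.

Let det_left t : 0 < det (T t) (u t).
Proof. by apply: tangent_det_gt0; lra. Qed.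

Let det_right t : 0 < det (u t) (T (t + 1)).
Proof. by apply: det_tangent_gt0; lra. Qed.

Let sqrtll : Num.sqrt (l * l) = l.
Proof. by rewrite -expr2 sqrtr_sqr gtr0_norm. Qed.

Let u1 t : (u t).1 = l * (rotv (de t) (T t)).1.
Proof. by have [+ _] := rotv_ang (det_left t); rewrite dotTT !mul1r dotuu sqrtll. Qed.

Let u2 t : (u t).2 = l * (rotv (de t) (T t)).2.
Proof. by have [_] := rotv_ang (det_left t); rewrite dotTT !mul1r dotuu sqrtll. Qed.

Lemma side_angle_bounds t : 0 < de t < pi.
Proof. by have [_ -> -> _ _] := angP (det_left t). Qed.

(* The tangents at both ends make the same angle with the chord, since its
   length is stationary. *)
Lemma side_angle_right t : ang (u t) (T (t + 1)) = de t.
Proof.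
have d1 := dX; have d2 := dY.
have sum0 : dot (u t) (T (t + 1)) = dot (u t) (T t).
  pose f s := (X (s + 1) - X s) ^+ 2 + (Y (s + 1) - Y s) ^+ 2.
  have df : is_derive t 1 f (2 * (dot (u t) (T (t + 1)) - dot (u t) (T t))).
    by rewrite /f; derive_by; rewrite /dot /u /g /T /=; ring.
  have : is_derive t 1 f 0.
    have -> : f = fun=> l ^+ 2 by apply/funext => s; rewrite /f side.
    exact: is_derive_cstf.
  case: df => _ e [_]; rewrite e => /eqP.
  by rewrite mulf_eq0 pnatr_eq0 /= subr_eq0 => /eqP.
have e1 : dot (u t) (T (t + 1)) = l * cos (de t).
  rewrite sum0 -[RHS](mulT1 t) /dot u1 u2 /=; ring.
apply: (ang_uniq (side_angle_bounds t) l_gt0 e1).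
have s0 : 0 < l * sin (de t) by rewrite mulr_gt0// sin_gt0_pi// side_angle_bounds.
have := sqr_dotDdet (u t) (T (t + 1)); rewrite dotuu dotTT mulr1 e1 => e2.
have : det (u t) (T (t + 1)) ^+ 2 = (l * sin (de t)) ^+ 2.
  have -> : (l * sin (de t)) ^+ 2 = l * l - (l * cos (de t)) ^+ 2.
    by rewrite !exprMn sin2cos2 -expr2; ring.
  by rewrite -e2; ring.
move=> /eqP; rewrite eqf_sqr => /orP[/eqP//|/eqP e3].
by have := det_right t; rewrite e3; lra.
Qed.

Let turn1 t : turn t (t + 1) = 2 * de t.
Proof. by rewrite /turn side_angle_right -/(u t) -/(de t); ring. Qed.

Let step_T s a v : T s = rotv a v -> T (s + 1) = rotv (a + 2 * de s) v.
Proof.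
by move=> e; rewrite [a + _]addrC rotvD -e -turn1; apply: rotv_turn; lra.
Qed.

Let step_u s a t : T s = rotv a (T t) ->
  dot (T t) (u s) = l * cos (a + de s) /\ det (T t) (u s) = l * sin (a + de s).
Proof.
move=> e; have n1 := dotTT t.
rewrite /dot /det u1 u2 e [a + _]addrC -[l * cos _]mulr1 -[l * sin _]mulr1.
rewrite -n1 cosD sinD /dot /=.
by split; ring.
Qed.

(** Six steps rotate the tangent by twice the sum and bring it back, so the sum is a multiple of
    [pi]. The turning over five steps is below [2 pi] and the last angle below [pi], so the sum lies
    in ]0, 2 pi[. *)
Lemma side_angle_sum t :
  de t + de (t + 1) + de (t + 2) + de (t + 3) + de (t + 4) + de (t + 5) = pi.
Proof.
have s1 (s : R) : s + 1 + 1 = s + 2 by ring.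
have s2 (s : R) : s + 2 + 1 = s + 3 by ring.
have s3 (s : R) : s + 3 + 1 = s + 4 by ring.
have s4 (s : R) : s + 4 + 1 = s + 5 by ring.
have s5 (s : R) : s + 5 + 1 = s + 6 by ring.
have h0 := side_angle_bounds t; have h1 := side_angle_bounds (t + 1).
have h2 := side_angle_bounds (t + 2); have h3 := side_angle_bounds (t + 3).
have h4 := side_angle_bounds (t + 4); have h5 := side_angle_bounds (t + 5).
have t2 : turn t (t + 2) = turn t (t + 1) + turn (t + 1) (t + 2) by apply: turnD; lra.
have t3 : turn t (t + 3) = turn t (t + 2) + turn (t + 2) (t + 3) by apply: turnD; lra.
have t4 : turn t (t + 4) = turn t (t + 3) + turn (t + 3) (t + 4) by apply: turnD; lra.
have t5 : turn t (t + 5) = turn t (t + 4) + turn (t + 4) (t + 5) by apply: turnD; lra.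
have t11 := turn1 (t + 1); rewrite s1 in t11.
have t22 := turn1 (t + 2); rewrite s2 in t22.
have t33 := turn1 (t + 3); rewrite s3 in t33.
have t44 := turn1 (t + 4); rewrite s4 in t44.
have T5 : turn t (t + 5) = 2 * (de t + de (t + 1) + de (t + 2) + de (t + 3) + de (t + 4)).
  by rewrite t5 t4 t3 t2 turn1 t11 t22 t33 t44; ring.
have T5lt : turn t (t + 5) < 2 * pi.
  rewrite /turn; have [|_ _ + _ _] := @angP _ (T t) (g (t + 5) - g t).
    by apply: tangent_det_gt0; lra.
  have [|_ _ + _ _] := @angP _ (g (t + 5) - g t) (T (t + 5)).
    by apply: det_tangent_gt0; lra.
  by move=> ? ?; lra.
set S := LHS.
have S0 : 0 < S < 2 * pi by rewrite /S; lra.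
have TS : T t = rotv (2 * S) (T t).
  have e0 : T t = rotv 0 (T t) by rewrite /rotv cos0 sin0 /=; congr (_, _); ring.
  rewrite -{1}[T t]T6 -s5.
  have := step_T e0; move=> /step_T; rewrite s1 => /step_T; rewrite s2 => /step_T.
  rewrite s3 => /step_T; rewrite s4 => /step_T; rewrite s5 => ->.
  by congr rotv; rewrite /S; ring.
have : cos (S + S) = 1.
  have := dotTT t; rewrite {2}TS => <-.
  transitivity (cos (2 * S) * dot (T t) (T t)); last by rewrite /dot /rotv /=; ring.
  by rewrite dotTT mulr1; congr cos; ring.
rewrite cosD; have := cos2Dsin2 S; rewrite !expr2 => c1 c2.
have /eqP : sin S * sin S = 0 by lra.
rewrite mulf_eq0 orbb => /eqP sS.
have [Spi|piS|//] := ltgtP S pi.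
  by have : 0 < sin S by [apply: sin_gt0_pi; lra]; lra.
have : 0 < sin (S - pi) by apply: sin_gt0_pi; lra.
by rewrite sinB sinpi cospi sS; lra.
Qed.

(* The hexagon is centrally symmetric: opposite sides are antiparallel. *)
Lemma side_angle_antipodal t : de t + 2 * de (t + 1) + 2 * de (t + 2) + de (t + 3) = pi.
Proof.
have s0 (s : R) : s - 1 + 1 = s by ring.
have s1 (s : R) : s - 1 + 2 = s + 1 by ring.
have s2 (s : R) : s - 1 + 3 = s + 2 by ring.
have s3 (s : R) : s - 1 + 4 = s + 3 by ring.
(* The two opposite sides play the roles of [p1] and [p4] in [alternating_hexagon], hence the shift
   by one. *)
rewrite -(s3 t) -(s2 t) -(s1 t) -{1}(s0 t); move: (t - 1) => {s0 s1 s2 s3} {}t.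
have s1 (s : R) : s + 1 + 1 = s + 2 by ring.
have s2 (s : R) : s + 2 + 1 = s + 3 by ring.
have s3 (s : R) : s + 3 + 1 = s + 4 by ring.
have s4 (s : R) : s + 4 + 1 = s + 5 by ring.
have s5 (s : R) : s + 5 + 1 = s + 6 by ring.
have h0 := side_angle_bounds t; have h1 := side_angle_bounds (t + 1).
have h2 := side_angle_bounds (t + 2); have h3 := side_angle_bounds (t + 3).
have h4 := side_angle_bounds (t + 4); have h5 := side_angle_bounds (t + 5).
have sum6 := side_angle_sum t.
have e0 : T t = rotv 0 (T t) by rewrite /rotv cos0 sin0 /=; congr (_, _); ring.
have e1 := step_T e0; have e2 := step_T e1; rewrite s1 in e2.
have e3 := step_T e2; rewrite s2 in e3.
have e4 := step_T e3; rewrite s3 in e4.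
have e5 := step_T e4; rewrite s4 in e5.
have [c0 f0] := step_u e0; have [c1 f1] := step_u e1; have [c2 f2] := step_u e2.
have [c3 f3] := step_u e3; have [c4 f4] := step_u e4; have [c5 f5] := step_u e5.
have ln0 : l != 0 by rewrite gt_eqF.
have closed (w : R * R -> R) : (forall p q r, w (p - q) + w (r - p) = w (r - q)) ->
  (forall p, w (p - p) = 0) -> w (u t) + w (u (t + 1)) + w (u (t + 2)) + w (u (t + 3)) +
  w (u (t + 4)) + w (u (t + 5)) = 0.
  by move=> w1 w2; rewrite /u s1 s2 s3 s4 s5 !w1 g6 w2.
have := closed (dot (T t)).
rewrite c0 c1 c2 c3 c4 c5 -!mulrDr => cl.
have /eqP := cl (fun p q r => ltac:(by rewrite /dot /=; ring))
  (fun p => ltac:(by rewrite /dot /=; ring)).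
rewrite mulf_eq0 (negPf ln0) => /eqP cE.
have := closed (det (T t)).
rewrite f0 f1 f2 f3 f4 f5 -!mulrDr => {}cl.
have /eqP := cl (fun p q r => ltac:(by rewrite /det /=; ring))
  (fun p => ltac:(by rewrite /det /=; ring)).
rewrite mulf_eq0 (negPf ln0) => /eqP sE.
have := alternating_hexagon cE sE.
have cos_neq0 (x : R) : 0 <= x < pi / 2 -> cos x != 0.
  by move=> x0; rewrite gt_eqF// cos_gt0_pihalf//; lra.
(* The alternating sum of the directions is the sum of the six angles. The first two factors are
   cosines of half sums of two of these angles, which are below [pi / 2], so the third factor
   vanishes. *)
move=> /(_ ltac:(lra)) /eqP; rewrite !mulf_eq0 => /orP[/orP[|]|].
- by rewrite (negPf (cos_neq0 _ _))//; lra.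
- by rewrite (negPf (cos_neq0 _ _))//; lra.
set x := _ / 2 => /eqP cx.
have x0 : 0 <= x <= pi by rewrite /x; lra.
suff : x = pi / 2 by rewrite /x; lra.
apply: cos_inj; rewrite ?in_itv ?cos_pihalf//=.
by have := @pi_ge0 R; lra.
Qed.

Let T3 t : T (t + 3) = rotv (2 * (de t + de (t + 1) + de (t + 2))) (T t).
Proof.
have s1 (s : R) : s + 1 + 1 = s + 2 by ring.
have s2 (s : R) : s + 2 + 1 = s + 3 by ring.
have e0 : T t = rotv 0 (T t) by rewrite /rotv cos0 sin0 /=; congr (_, _); ring.
rewrite -s2; have /step_T := e0; move=> /step_T; rewrite s1 => /step_T ->.
by congr rotv; ring.
Qed.

Lemma opposite_side t : u (t + 3) = - u t.
Proof.
have e : rotv (de (t + 3)) (T (t + 3)) = - rotv (de t) (T t).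
  rewrite T3 -rotvD.
  have -> : de (t + 3) + 2 * (de t + de (t + 1) + de (t + 2)) = de t + pi.
    by have := side_angle_antipodal t; lra.
  by rewrite /rotv cosDpi sinDpi /=; congr (_, _) => /=; ring.
apply: injective_projections.
  by transitivity (- (u t).1) => //; rewrite !u1 e /=; ring.
by transitivity (- (u t).2) => //; rewrite !u2 e /=; ring.
Qed.

Lemma sin_side_angle t : (2 * sin (de t)) ^+ 2 = dot (T (t + 1) - T t) (T (t + 1) - T t).
Proof.
have -> : T (t + 1) = rotv (2 * de t) (T t) by rewrite -turn1; apply: rotv_turn; lra.
transitivity ((cos (2 * de t) ^+ 2 + sin (2 * de t) ^+ 2 + 1
  - 2 * cos (2 * de t)) * dot (T t) (T t)); last first.
  by rewrite /rotv /dot /=; ring.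
rewrite cos2Dsin2 dotTT (_ : 2 * de t = de t + de t) ?cosD; last by ring.
by have := cos2Dsin2 (de t); rewrite !expr2; lra.
Qed.

(** Differentiating [opposite_side] gives opposite differences of tangents, hence equal sines by
    [sin_side_angle]. Supplementary angles are excluded because [side_angle_antipodal] makes
    [de t + de (t + 3)] less than [pi]. *)
Lemma side_angle_period t : de (t + 3) = de t.
Proof.
have d1 := dX; have d2 := dY.
have s1 (s : R) : s + 3 + 1 = s + 4 by ring.
have eqd (f : R -> R) (a b : R) : is_derive t 1 f a ->
    is_derive t 1 (fun s => - f s) b -> b = - a.
  by move=> da [_ <-]; have [_ <-] := is_derive_oppf da.
have e1 : T (t + 4) - T (t + 3) = - (T (t + 1) - T t).
  have op s : g (s + 4) - g (s + 3) = - (g (s + 1) - g s).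
    by rewrite -(opposite_side s) /u s1.
  apply: injective_projections.
    apply: (eqd (fun s => X (s + 1) - X s)); first by derive_by.
    rewrite (_ : (fun s => - _) = fun s => X (s + 4) - X (s + 3)); first by derive_by.
    by apply/funext => s; have := congr1 fst (op s).
  apply: (eqd (fun s => Y (s + 1) - Y s)); first by derive_by.
  rewrite (_ : (fun s => - _) = fun s => Y (s + 4) - Y (s + 3)); first by derive_by.
  by apply/funext => s; have := congr1 snd (op s).
have es : sin (de (t + 3)) = sin (de t).
  have : (2 * sin (de (t + 3))) ^+ 2 = (2 * sin (de t)) ^+ 2.
    by rewrite !sin_side_angle s1 e1 /dot /=; ring.
  have p1 : 0 < sin (de t) by rewrite sin_gt0_pi// side_angle_bounds.
  have p2 : 0 < sin (de (t + 3)) by rewrite sin_gt0_pi// side_angle_bounds.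
  by move=> /eqP; rewrite eqf_sqr => /orP[] /eqP; lra.
have b0 := side_angle_bounds t; have b1 := side_angle_bounds (t + 1).
have b2 := side_angle_bounds (t + 2); have b3 := side_angle_bounds (t + 3).
have sum := side_angle_antipodal t.
have := sin_sub (de (t + 3)) (de t); rewrite es subrr => /esym/eqP.
have c0 : 0 < cos ((de (t + 3) + de t) / 2) by apply: cos_gt0_pihalf; lra.
rewrite mulf_eq0 pnatr_eq0 /= mulf_eq0 (gt_eqF c0) orbF => /eqP s0.
have [lt|gt|//] := ltgtP (de (t + 3)) (de t).
  have : 0 < sin ((de t - de (t + 3)) / 2) by apply: sin_gt0_pi; lra.
  have -> : (de t - de (t + 3)) / 2 = - ((de (t + 3) - de t) / 2) by ring.
  by rewrite sinN s0; lra.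
have : 0 < sin ((de (t + 3) - de t) / 2) by apply: sin_gt0_pi; lra.
by rewrite s0; lra.
Qed.

Lemma side_angle_sum3 t : de t + de (t + 1) + de (t + 2) = pi / 2.
Proof.
by have := side_angle_antipodal t; rewrite side_angle_period; lra.
Qed.

Let sumT t s : de t = s -> T (t + 1) = rotv (2 * s) (T t).
Proof. by move=> <-; rewrite -turn1; apply: rotv_turn; lra. Qed.

(** * The delay equation, bounds on the side, and the circle *)

Lemma side_angle_derive t :
  is_derive t 1 de (2 / l * (sin (de (t + 1)) - sin (de (t + 2)))).
Proof.
have d1 := dX; have d2 := dY.
have s1 (s : R) : s + 1 + 1 = s + 2 by ring.
have s2 (s : R) : s + 1 + 2 = s + 3 by ring.
have ln0 : l != 0 by rewrite gt_eqF.
have b s := side_angle_bounds s; have sum3 s := side_angle_sum3 s.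
have dot_uu s : dot (u s) (u (s + 1)) = l ^+ 2 * sin (de (s + 2)).
  have -> : de (s + 2) = pi / 2 - (de s + de (s + 1)) by have := sum3 s; lra.
  rewrite sinB sin_pihalf cos_pihalf mul1r mul0r subr0.
  transitivity (l ^+ 2 * cos (de s + de (s + 1)) * dot (T s) (T s));
    last by rewrite dotTT mulr1.
  have e : rotv (de (s + 1)) (T (s + 1)) = rotv (2 * de s + de (s + 1)) (T s).
    by rewrite (sumT erefl) -rotvD addrC.
  have <- : 2 * de s + de (s + 1) - de s = de s + de (s + 1) by ring.
  by rewrite -mulrA -dot_rotv {1}/dot !u1 !u2 e /dot; ring.
(* The cosine of an exterior angle of the hexagon is differentiable by construction and equals
   [sin (de s)]; differentiability of [de] follows through [asin]. *)
pose f s := ((X (s + 2) - X (s + 1)) * (X (s + 3) - X (s + 2)) +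
             (Y (s + 2) - Y (s + 1)) * (Y (s + 3) - Y (s + 2))) / l ^+ 2.
have s3 (s : R) : s + 2 + 1 = s + 3 by ring.
have fE s : f s = sin (de s).
  have := dot_uu (s + 1); rewrite s2 side_angle_period => e.
  by rewrite -[RHS](mulKf (expf_neq0 2 ln0)) -e /dot /u !(s1, s2, s3) /= /f mulrC.
have df : is_derive t 1 f (cos (de t) * (2 / l * (sin (de (t + 1)) - sin (de (t + 2))))).
  rewrite /f; derive_by.
  have -> : cos (de t) = sin (de (t + 1) + de (t + 2)).
    by rewrite -cosBpihalf; have := sum3 t => <-; rewrite -cosN; congr cos; ring.
  set v := T (t + 1); set a := de (t + 1); set c := de (t + 2).
  have ea : T (t + 1) = v by [].
  have T2 : T (t + 2) = rotv (2 * a) v by rewrite -s1; apply: sumT.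
  have T3' : T (t + 3) = rotv (2 * a + 2 * c) v.
    by rewrite -s3 (sumT (erefl (de (t + 2)))) T2 -rotvD addrC.
  have u2' : rotv c (T (t + 2)) = rotv (2 * a + c) v by rewrite T2 -rotvD addrC.
  transitivity ((dot (T (t + 2)) (u (t + 2)) - dot v (u (t + 2)) +
                 (dot (u (t + 1)) (T (t + 3)) - dot (u (t + 1)) (T (t + 2)))) / l ^+ 2).
    by rewrite /dot /u !(s1, s2, s3) /=; ring.
  have -> : dot (T (t + 2)) (u (t + 2)) = l * cos c.
    rewrite -[RHS](mulT1 (t + 2)) /dot !u1 !u2 /=; ring.
  have -> : dot v (u (t + 2)) = l * cos (2 * a + c).
    rewrite -[RHS](mulT1 (t + 1)) /dot !u1 !u2 u2' /=; ring.
  have dotu (b' : R) : dot (u (t + 1)) (rotv b' v) = l * cos (b' - a).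
    by rewrite -[RHS](mulT1 (t + 1)) -mulrA -dot_rotv /dot !u1 !u2; ring.
  rewrite T3' T2 !dotu.
  (* With all arguments written as [a + c] plus or minus [a] or [c], the terms in [cos (a + c)]
     cancel and [sin (a + c)] factors out. *)
  have -> : cos c = cos (a + c - a) by congr cos; ring.
  have -> : 2 * a + c = a + c + a by ring.
  have -> : 2 * a + 2 * c - a = a + c + c by ring.
  have -> : 2 * a - a = a + c - c by ring.
  by rewrite !(cosD (a + c)) !cosN !sinN; field.
have deE : de = fun s => asin (f s).
  by apply/funext => s; rewrite fE sinK// in_itv /=; have := sum3 s; have := b s;
    have := b (s + 1); have := b (s + 2); lra.
have bt : 0 < de t < pi / 2.
  by have := sum3 t; have := b t; have := b (t + 1); have := b (t + 2); lra.
have c0 : 0 < cos (de t) by apply: cos_gt0_pihalf; lra.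
have s0 : 0 < sin (de t) by apply: sin_gt0_pihalf; lra.
have ft : -1 < f t < 1.
  by rewrite fE; have := cos2Dsin2 (de t); nra.
have := is_derive_compf (is_derive1_asin ft) df; rewrite -deE.
by rewrite fE -cos2sin2 sqrtr_sqr gtr0_norm// mulKf// gt_eqF.
Qed.

(** A chord is no longer than its arc, here of length 1: the derivative of [f] is nonnegative by
    Cauchy-Schwarz. *)
Lemma side_le1 : l <= 1.
Proof.
have d1 := dX; have d2 := dY.
pose f s := l * s - ((X s - X 0) * (u 0).1 + (Y s - Y 0) * (u 0).2).
have df (s : R) : is_derive s 1 f (l - dot (T s) (u 0)).
  by rewrite /f; derive_by; rewrite /dot /T /=; ring.
have := le_of_derive_ge0 (ler01 : 0 <= 1 :> R) (fun s _ => df s).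
have -> : f 0 = 0 by rewrite /f !subrr !mul0r mulr0 addr0 subr0.
have -> : f 1 = l * (1 - l).
  by have := dotuu 0; rewrite /f /dot /u add0r /= => ->; ring.
rewrite pmulr_rge0// subr_ge0; apply => s _; rewrite subr_ge0.
have := sqr_dotDdet (T s) (u 0); rewrite dotTT dotuu mul1r.
have := sqr_ge0 (det (T s) (u 0)).
set e : R := det _ _ ^+ 2; set d : R := dot _ _ => e0 E.
rewrite leNgt; apply/negP => ld.
have dl : 0 < d + l by rewrite addr_gt0// (lt_trans l_gt0).
have : 0 < (d - l) * (d + l) by rewrite mulr_gt0// subr_gt0.
have -> : (d - l) * (d + l) = (d ^+ 2 + e - l * l) - e by ring.
by rewrite E subrr sub0r oppr_gt0 ltNge e0.
Qed.

(** By convexity the tangent along the arc makes an angle at most [de t] with the chord, so the arc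
    of length 1 projects onto the chord with length at least [cos (de t)]. *)
Lemma cos_side_angle_le t : cos (de t) <= l.
Proof.
have d1 := dX; have d2 := dY.
have b0 := side_angle_bounds t; have b1 := side_angle_bounds (t + 1).
have b2 := side_angle_bounds (t + 2); have sum := side_angle_sum3 t.
pose f s := ((X s - X t) * (u t).1 + (Y s - Y t) * (u t).2) - l * cos (de t) * s.
have df (s : R) : is_derive s 1 f (dot (T s) (u t) - l * cos (de t)).
  by rewrite /f; derive_by; rewrite /dot /T /=; ring.
have tt1 : t <= t + 1 by lra.
have := le_of_derive_ge0 tt1 (fun s _ => df s).
have -> : f t = - (l * cos (de t) * t) by rewrite /f !subrr !mul0r addr0 sub0r.
have -> : f (t + 1) = l * (l - cos (de t)) - l * cos (de t) * t.
  by have := dotuu t; rewrite /f /dot /u /= => ->; ring.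
move=> H; suff : 0 <= l * (l - cos (de t)) by rewrite pmulr_rge0// subr_ge0.
rewrite -[leRHS](addrNK (l * cos (de t) * t)) -lerBlDr sub0r; apply: H => s /andP[ts st].
have dotTu (a : R) : dot (rotv a (T t)) (u t) = l * cos (de t - a).
  by rewrite -[RHS](mulT1 t) -mulrA -dot_rotv /dot !u1 !u2; ring.
suff [a ab ->] : exists2 a, 0 <= a <= 2 * de t & T s = rotv a (T t).
  rewrite dotTu -mulrBr mulr_ge0 ?(ltW l_gt0)// subr_ge0.
  have [ad|da] := leP a (de t).
    have [->|a0] := eqVneq a 0; first by rewrite subr0.
    have a0' : 0 < a by rewrite lt_neqAle eq_sym a0; lra.
    by rewrite ltW// ltr_cos ?in_itv /=; lra.
  rewrite -[leRHS]cosN; have [->|a0] := eqVneq a (2 * de t).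
    by rewrite le_eqVlt; apply/orP; left; apply/eqP; congr cos; ring.
  have a0' : a < 2 * de t by rewrite lt_neqAle a0; lra.
  by rewrite ltW// ltr_cos ?in_itv /=; lra.
move: ts; rewrite le_eqVlt => /predU1P[<-|ts].
  exists 0; first by lra.
  by rewrite /rotv cos0 sin0 /=; congr (_, _); ring.
move: st; rewrite le_eqVlt => /predU1P[->|st].
  by exists (2 * de t); [lra|exact: sumT].
exists (turn t s); last by apply: rotv_turn; lra.
have := @turnD t s (t + 1) ts st; rewrite turn1 => -> //; last by lra.
have [|_ ? ? _ _] := @angP _ (T t) (g s - g t); first by apply: tangent_det_gt0; lra.
have [|_ ? ? _ _] := @angP _ (g s - g t) (T s); first by apply: det_tangent_gt0; lra.
have [|_ ? ? _ _] := @angP _ (T s) (g (t + 1) - g s).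
  by apply: tangent_det_gt0; lra.
have [|_ ? ? _ _] := @angP _ (g (t + 1) - g s) (T (t + 1)).
  by apply: det_tangent_gt0; lra.
by rewrite /turn; lra.
Qed.

Lemma side_angle_const t : de t = pi / 6.
Proof.
have s30 : 0 <= (Num.sqrt 3 : R) by [].
have s32 := sqr_sqrt3 R.
apply: (@cyclic_delay_rigidity _ de (2 / l)).
- by rewrite ler_pdivlMr//; have := side_le1; lra.
- rewrite mulrAC ler_pdivrMr//.
  suff : Num.sqrt 3 / 2 <= l by move: s32; rewrite expr2; lra.
  (* One of three angles with sum [pi / 2] is at most [pi / 6]; its cosine bounds [l] from below. *)
  have [s sle] : exists s, de s <= pi / 6.
    have := side_angle_sum3 t.
    have [?|?] := leP (de t) (pi / 6); first by exists t.
    have [?|?] := leP (de (t + 1)) (pi / 6); first by exists (t + 1).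
    by exists (t + 2); lra.
  apply: le_trans (cos_side_angle_le s); rewrite -cos_pi6.
  move: sle; rewrite le_eqVlt => /predU1P[->//|sle].
  have bs := side_angle_bounds s; have p0 := @pi_gt0 R.
  by rewrite ltW// ltr_cos ?in_itv /=; lra.
- by move=> s; have := side_angle_bounds s; lra.
- exact: side_angle_sum3.
- exact: side_angle_derive.
Qed.

Lemma equilateral_hexagon_circle :
  exists c1 c2, forall t, (X t - c1) ^+ 2 + (Y t - c2) ^+ 2 = l ^+ 2.
Proof.
have d1 := dX; have d2 := dY.
pose a := pi / 3 : R.
(* The centre is the apex of the equilateral triangle on a side. Tangents one step apart differ by
   the rotation [z = exp (i pi / 3)], and [1 - z + z ^ 2 = 0] makes its velocity zero. *)
pose c1 t := X t + (cos a * (X (t + 1) - X t) - sin a * (Y (t + 1) - Y t)).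
pose c2 t := Y t + (sin a * (X (t + 1) - X t) + cos a * (Y (t + 1) - Y t)).
have ca : cos a = 1 / 2.
  have -> : a = - (pi / 6) + pi / 2 by rewrite /a; lra.
  by rewrite cosDpihalf sinN opprK sin_pi6.
have T1 t : T (t + 1) = rotv a (T t).
  by rewrite (sumT (side_angle_const t)); congr rotv; rewrite /a; lra.
have sa : sin a ^+ 2 = 3 / 4 by rewrite sin2cos2 ca; field.
have TE t : U (t + 1) = cos a * U t - sin a * V t /\
    V (t + 1) = sin a * U t + cos a * V t.
  by have := T1 t => -[-> ->].
have dc1 (t : R) : is_derive t 1 c1 0.
  rewrite /c1; derive_by; have [-> ->] := TE t.
  rewrite ca; transitivity ((3 / 4 - sin a ^+ 2) * U t).
    by field.
  by rewrite sa subrr mul0r.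
have dc2 (t : R) : is_derive t 1 c2 0.
  rewrite /c2; derive_by; have [-> ->] := TE t.
  rewrite ca; transitivity ((3 / 4 - sin a ^+ 2) * V t).
    by field.
  by rewrite sa subrr mul0r.
exists (c1 0); exists (c2 0); move=> t.
rewrite (is_derive_0_is_cst 0 t dc1) (is_derive_0_is_cst 0 t dc2).
rewrite -(side t).
transitivity ((cos a ^+ 2 + sin a ^+ 2) *
  ((X (t + 1) - X t) ^+ 2 + (Y (t + 1) - Y t) ^+ 2)).
  by rewrite /c1 /c2; ring.
by rewrite cos2Dsin2 mul1r.
Qed.

End Curve.

(** * Convex bodies and their boundary *)

Section Frontier.
Variable R : realType.
Implicit Types (K : set 'rV[R]_2) (x y z c : 'rV[R]_2).

(** Otherwise the closure and the interior of [K] have the same trace on the segment, which is then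
    clopen and, by connectedness, everything. *)
Lemma boundary_on_segment K x y : K x -> ~ K y ->
  exists s : R, 0 <= s <= 1 /\ boundary K (x + s *: (y - x)).
Proof.
move=> Kx Ky; apply: contrapT => nobd.
pose f (s : R) := x + s *: (y - x).
have cf : continuous f.
  by move=> s; apply: cvgD; [exact: cvg_cst|exact: scalel_continuous].
have inK s : 0 <= s <= 1 -> closure K (f s) -> K° (f s).
  by move=> s01 cs; apply: contrapT => ns; apply: nobd; exists s.
have f0 : f 0 = x by rewrite /f scale0r addr0.
have f1 : f 1 = y by rewrite /f scale1r addrC subrK.
have E : `[0, 1]%classic `&` f @^-1` K° = `[0, 1]%classic.
  apply: (@segment_connected R 0 1).
  - exists 0; split => /=; first by rewrite in_itv /= lexx ler01.
    by apply: inK; rewrite ?lexx ?ler01// f0; exact: subset_closure.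
  - exists (f @^-1` K°) => //.
    by apply: open_comp => //; exact: open_interior.
  - exists (f @^-1` closure K).
      by apply: preimage_closed => //; exact: closed_closure.
    apply/seteqP; split => s [/= s01 h]; split => //.
      by apply: subset_closure; exact: interior_subset.
    by apply: inK => //; move: s01; rewrite in_itv.
apply: Ky; rewrite -f1; apply: interior_subset.
suff [] : (`[0, 1]%classic `&` f @^-1` K°) 1 by [].
by rewrite E /= in_itv /= lexx ler01.
Qed.

Definition sqnorm x := x 0 0 ^+ 2 + x 0 1 ^+ 2.

Lemma enormE x : enorm x = Num.sqrt (sqnorm x).
Proof.
rewrite /enorm /sqnorm !big_ord_recl big_ord0 addr0; congr (Num.sqrt (_ + x _ _ ^+ 2)).
exact: val_inj.
Qed.

Lemma enorm_le x r : 0 <= r -> (enorm x <= r) = (sqnorm x <= r ^+ 2).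
Proof.
by move=> r0; rewrite enormE -{1}(ger0_norm r0) -sqrtr_sqr ler_sqrt// sqr_ge0.
Qed.

Lemma enorm_eq x r : enorm x = r -> sqnorm x = r ^+ 2.
Proof. by rewrite enormE => <-; rewrite sqr_sqrtr// addr_ge0 ?sqr_ge0. Qed.

Lemma rV2P x y : x 0 0 = y 0 0 -> x 0 1 = y 0 1 -> x = y.
Proof.
move=> e0 e1; apply/rowP => -[[|[|//]] i].
  by move: e0; congr (_ = _); congr (_ _ _); exact: val_inj.
by move: e1; congr (_ = _); congr (_ _ _); exact: val_inj.
Qed.

(** From a point of [K] outside the circle, moving radially outwards meets the boundary even farther
    away. From an interior point towards a missing point of the disk, the boundary is met strictly
    in between, where strict convexity of the squared distance puts it inside the circle. *)
Lemma is_disk_of_boundary K c r : compact K -> K° !=set0 -> 0 < r ->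
  (forall x, boundary K x -> sqnorm (x - c) = r ^+ 2) -> is_disk K.
Proof.
move=> cK [y0 iy0] r0 bd; exists c, r; split => //.
have subK : forall x, K x -> sqnorm (x - c) <= r ^+ 2.
  move=> x Kx; rewrite leNgt; apply/negP => out.
  have xc0 : 0 < `|x - c|.
    rewrite normr_gt0; apply/eqP => xc; move: out.
    by rewrite xc /sqnorm !mxE expr0n /= addr0 ltNge sqr_ge0.
  have [M [_ Mb]] := compact_bounded cK.
  (* Far enough for the norm to exceed the bound [|M| + 1] on [K]. *)
  pose s := (`|M| + 2 + `|x|) / `|x - c|.
  have s0 : 0 <= s by rewrite divr_ge0// addr_ge0// addr_ge0.
  have [|u [u01]] := @boundary_on_segment K x (x + s *: (x - c)) Kx.
    move=> /(Mb (`|M| + 1)); rewrite (le_lt_trans (ler_norm M)) ?ltrDl// => /(_ isT).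
    apply/negP; rewrite -ltNge.
    have : `|s *: (x - c)| <= `|x + s *: (x - c)| + `|x|.
      by rewrite -{1}(addKr x (s *: (x - c))) addrC; apply: ler_normB.
    rewrite normrZ ger0_norm// /s divfK ?gt_eqF//.
    by set w := `|x + _|; lra.
  move=> /bd; rewrite [x + s *: _ - x]addrAC subrr add0r scalerA => E.
  move: out; rewrite -E; apply/negP; rewrite -leNgt.
  have us : 0 <= u * s by rewrite mulr_ge0//; lra.
  have e i : (x + (u * s) *: (x - c) - c) 0 i = (1 + u * s) * (x - c) 0 i.
    by rewrite !mxE; ring.
  rewrite /sqnorm !e; set p := _ 0 0; set q := _ 0 1.
  have -> : ((1 + u * s) * p) ^+ 2 + ((1 + u * s) * q) ^+ 2 =
    (1 + u * s) ^+ 2 * (p ^+ 2 + q ^+ 2) by ring.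
  by rewrite ler_peMl ?addr_ge0 ?sqr_ge0// expr_ge1 ?addr_ge0// lerDl.
have Ky0 := interior_subset iy0.
apply/seteqP; split => x /=; first by rewrite enorm_le ?(ltW r0)//; exact: subK.
rewrite enorm_le ?(ltW r0)// => xin; apply: contrapT => nKx.
have [s [s01 bz]] := boundary_on_segment Ky0 nKx.
have s0 : s != 0.
  by apply/eqP => s0; move: bz; rewrite s0 scale0r addr0 => -[].
have s1 : s != 1.
  apply/eqP => s1; move: bz; rewrite s1 scale1r addrC subrK => -[+ _].
  rewrite -(closure_id K).1 => //; exact: compact_closed (@norm_hausdorff _ _) cK.
have xy0 : 0 < sqnorm (x - y0).
  rewrite lt_neqAle addr_ge0 ?sqr_ge0// andbT eq_sym paddr_eq0 ?sqr_ge0//.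
  rewrite !sqrf_eq0 !mxE !subr_eq0.
  by apply/andP => -[/eqP e0 /eqP e1]; apply: nKx; rewrite (rV2P e0 e1).
have := bd _ bz; have := subK _ Ky0.
have -> : sqnorm (y0 + s *: (x - y0) - c) =
  (1 - s) * sqnorm (y0 - c) + s * sqnorm (x - c) - s * (1 - s) * sqnorm (x - y0).
  by rewrite /sqnorm !mxE; ring.
have s01' : 0 < s < 1 by rewrite !lt_neqAle eq_sym s0 s1 /=; lra.
set a := sqnorm (y0 - c); set b := sqnorm (x - c) in xin *.
set d := sqnorm (x - y0) in xy0 * => ar E.
have : 0 <= (1 - s) * (r ^+ 2 - a) by rewrite mulr_ge0 ?subr_ge0//; lra.
have : 0 <= s * (r ^+ 2 - b) by rewrite mulr_ge0 ?subr_ge0//; lra.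
have : 0 < s * (1 - s) * d by rewrite !mulr_gt0//; lra.
lra.
Qed.
End Frontier.

(** * Orientation and injectivity of the boundary curve *)

Section Orientation.
Variable R : realType.

(** Of three collinear points one is strictly between the others, hence interior. The coordinate [m]
    of [z], with [x] at 0 and [y] at 1, tells which. *)
Lemma boundary_noncollinear (K : set 'rV[R]_2) (x y z : 'rV[R]_2) :
    closed K -> strictly_convex K -> boundary K x -> boundary K y -> boundary K z ->
    x != y -> y != z -> x != z ->
  (y 0 0 - x 0 0) * (z 0 1 - x 0 1) - (y 0 1 - x 0 1) * (z 0 0 - x 0 0) != 0.
Proof.
move=> clK sK bx by_ bz xy yz xz; apply/negP => /eqP col.
have bdK p : boundary K p -> K p by move=> -[+ _]; rewrite -(closure_id K).1.
have between (p q r : 'rV[R]_2) (s : R) : boundary K p -> boundary K q -> boundary K r ->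
    q != r -> 0 < s < 1 -> p <> s *: q + (1 - s) *: r.
  by move=> [_ np] /bdK Kq /bdK Kr qr s01 e; apply: np; rewrite e; exact: sK.
set p := y 0 0 - x 0 0 in col; set q := y 0 1 - x 0 1 in col.
have n0 : 0 < p ^+ 2 + q ^+ 2.
  rewrite lt_neqAle addr_ge0 ?sqr_ge0// andbT eq_sym paddr_eq0 ?sqr_ge0//.
  rewrite !sqrf_eq0 !subr_eq0; apply: contraNN xy => /andP[/eqP e0 /eqP e1].
  by apply/eqP; apply: rV2P.
pose m := ((z 0 0 - x 0 0) * p + (z 0 1 - x 0 1) * q) / (p ^+ 2 + q ^+ 2).
have nn0 : p ^+ 2 + q ^+ 2 != 0 by rewrite gt_eqF.
have z0 : z 0 0 = x 0 0 + m * p.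
  apply/eqP; rewrite -subr_eq0; apply/eqP.
  transitivity (- (p * (z 0 1 - x 0 1) - q * (z 0 0 - x 0 0)) * q / (p ^+ 2 + q ^+ 2)).
    by rewrite /m; field.
  by rewrite col oppr0 !mul0r.
have z1 : z 0 1 = x 0 1 + m * q.
  apply/eqP; rewrite -subr_eq0; apply/eqP.
  transitivity ((p * (z 0 1 - x 0 1) - q * (z 0 0 - x 0 0)) * p / (p ^+ 2 + q ^+ 2)).
    by rewrite /m; field.
  by rewrite col !mul0r.
have [m0|m0|m0] := ltgtP m 0.
- have m1 : 1 - m != 0 by rewrite gt_eqF//; lra.
  apply: (between x y z (- m / (1 - m))) => //.
    by rewrite divr_gt0 ?ltr_pdivrMr; lra.
  by apply: rV2P; rewrite !mxE ?z0 ?z1 /p /q; field.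
- have [m1|m1|m1] := ltgtP m 1.
  + apply: (between z y x m) => //; [by rewrite eq_sym|by rewrite m0|].
    by apply: rV2P; rewrite !mxE ?z0 ?z1 /p /q; ring.
  + have mn0 : m != 0 by rewrite gt_eqF.
    apply: (between y z x m^-1) => //; first by rewrite eq_sym.
      by rewrite invr_gt0 m0 invf_lt1.
    by apply: rV2P; rewrite !mxE ?z0 ?z1 /p /q; field.
  + by move/eqP: yz; apply; apply: rV2P; rewrite ?z0 ?z1 m1 /p /q; ring.
- by move/eqP: xz; apply; apply: rV2P; rewrite ?z0 ?z1 m0; ring.
Qed.

Lemma nonvanishing_gt0 (f df : R -> R) : (forall t : R, is_derive t 1 f (df t)) ->
  (forall t, 0 <= t <= 1 -> f t != 0) -> 0 < f 0 -> 0 < f 1.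
Proof.
move=> dfP f0 f00; rewrite ltNge; apply/negP => f10.
have [||c] := @IVT R f 0 1 0 (ler01 : 0 <= 1 :> R).
- apply: derivable_within_continuous => x _; by case: (dfP x).
- by rewrite ge_min f10 orbT le_max ltW.
by rewrite in_itv /= => /f0 /eqP.
Qed.

(** The admissible triples form a convex set, so the straight path from (0, 1, 2) to any of them
    keeps the determinant nonzero and its sign constant. *)
Lemma orientation_const (X Y U V : R -> R) :
    (forall t : R, is_derive t 1 X (U t)) -> (forall t : R, is_derive t 1 Y (V t)) ->
    let D a b c := det ((X b, Y b) - (X a, Y a)) ((X c, Y c) - (X a, Y a)) in
    (forall a b c, a < b -> b < c -> c < a + 6 -> D a b c != 0) ->
  (forall a b c, a < b -> b < c -> c < a + 6 -> 0 < D a b c) \/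
  (forall a b c, a < b -> b < c -> c < a + 6 -> D a b c < 0).
Proof.
move=> dX dY D D0.
pose F a b c s := (X (1 + s * (b - 1)) - X (s * a)) * (Y (2 + s * (c - 2)) - Y (s * a)) -
   (Y (1 + s * (b - 1)) - Y (s * a)) * (X (2 + s * (c - 2)) - X (s * a)).
have FE a b c s : F a b c s = D (s * a) (1 + s * (b - 1)) (2 + s * (c - 2)) by [].
have F0 a b c : F a b c 0 = D 0 1 2 by rewrite FE !mul0r !addr0.
have F1 a b c : F a b c 1 = D a b c by rewrite FE !mul1r !subrKC.
have Fn0 a b c s : a < b -> b < c -> c < a + 6 -> 0 <= s <= 1 -> F a b c s != 0.
  by move=> ab bc ca s01; rewrite FE; apply: D0; nra.
have dF a b c : exists df, forall s : R, is_derive s 1 (F a b c) (df s).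
  by eexists => s; rewrite /F; repeat derive_step.
have base : D 0 1 2 != 0 by apply: D0; lra.
have [neg|pos|] := ltgtP (D 0 1 2) 0; last by move/eqP; rewrite (negPf base).
  right=> a b c ab bc ca; have [df dFP] := dF a b c.
  rewrite -oppr_gt0 -F1.
  apply: (nonvanishing_gt0 (fun s => is_derive_oppf (dFP s))) => [s s01|].
    by rewrite oppr_eq0 Fn0.
  by rewrite F0 oppr_gt0.
left=> a b c ab bc ca; have [df dFP] := dF a b c.
by rewrite -F1; apply: (nonvanishing_gt0 dFP) => [s s01|]; rewrite ?F0 ?Fn0.
Qed.

Lemma periodic_injective (T : Type) (P : R) (f : R -> T) (a b : R) : 0 < P ->
  (forall t, f (t + P) = f t) -> {in `[0, P[ &, injective f} ->
  a < b -> b < a + P -> f a <> f b.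
Proof.
move=> P0 per inj ab ba.
have pern n t : f (t + n%:R * P) = f t.
  elim: n t => [|n IH] t; first by rewrite mul0r addr0.
  by rewrite -natr1 mulrDl mul1r addrA per IH.
have perz (z : int) t : f (t - z%:~R * P) = f t.
  case: z => n; first by rewrite -[in RHS](subrK (n%:R * P) t) pern.
  by rewrite NegzE mulrNz mulNr opprK pern.
pose n := Num.floor (a / P).
have /andP[n1 n2] := floor_itv (a / P); rewrite -/n in n1 n2.
have a1 : n%:~R * P <= a by rewrite -ler_pdivlMr.
have a2 : a < n%:~R * P + P.
  by move: n2; rewrite intrD1 ltr_pdivrMr// mulrDl mul1r.
rewrite -(perz n a) -(perz n b).
move: a1 a2; set w := n%:~R * P => a1 a2 E.
(* With [a] moved into [0, P[, the point [b] falls in the same period or in the next one. *)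
have [bP|bP] := ltP (b - w) P.
  have : a - w = b - w by apply: inj => //; rewrite in_itv /=; lra.
  by lra.
have := per (b - w - P); rewrite subrK => Eb.
have : a - w = b - w - P by rewrite Eb in E; apply: inj => //; rewrite in_itv /=; lra.
by lra.
Qed.

End Orientation.

(** * Rescaling the boundary and conclusion *)

Theorem theorem1 (R : realType) (K : set 'rV[R]_2)
  (bodyK : convex_body K) (strictK : strictly_convex K)
  (C1K : C1_boundary K) (floatK : floats_in_every_position K 6) :
  is_disk K.
Proof.
have [cK _ iK] := bodyK.
have clK : closed K := compact_closed (@norm_hausdorff _ _) cK.
have [P [gamma [[[P0 per inj range_gamma [dgamma _]] speed] [l l0 side]]]] := floatK.
(* Scaling both the parameter and the plane by [h] gives period 6, keeps unit speed and turns the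
   side into [l / h]. *)
pose h := P / 6; have h0 : 0 < h by rewrite divr_gt0.
have hn0 : h != 0 by rewrite gt_eqF.
have h6 : h * 6 = P by rewrite /h; field.
pose X t := gamma (h * t) 0 0 / h; pose Y t := gamma (h * t) 0 1 / h.
pose U t := derive1 gamma (h * t) 0 0; pose V t := derive1 gamma (h * t) 0 1.
have dcoord (i : 'I_2) (t : R) :
    is_derive t 1 (fun s => gamma (h * s) 0 i / h) (derive1 gamma (h * t) 0 i).
  have dg (s : R) : is_derive s 1 (fun s => gamma s 0 i : R) (derive1 gamma s 0 i).
    split; first by have /derivable_mxP := dgamma s; exact.
    by rewrite derive1E derive_mx ?mxE.
  derive_by.
    exact: (is_derive_compf (f := fun s => gamma s 0 i) (dg _)
      (is_derive_mulf (is_derive_cstf h _) (is_derive_idf _))).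
  rewrite /=; by field.
have dX (t : R) : is_derive t 1 X (U t) := dcoord 0 t.
have dY (t : R) : is_derive t 1 Y (V t) := dcoord 1 t.
have X6 t : X (t + 6) = X t by rewrite /X mulrDr h6 per.
have Y6 t : Y (t + 6) = Y t by rewrite /Y mulrDr h6 per.
have UV t : U t ^+ 2 + V t ^+ 2 = 1.
  by rewrite -[RHS](expr1n _ 2); exact: enorm_eq (speed _).
have sideXY t : (X (t + 1) - X t) ^+ 2 + (Y (t + 1) - Y t) ^+ 2 = (l / h) ^+ 2.
  have := enorm_eq (side (h * t) ord0).
  rewrite /inscribed_vertex /= modn_small// mul1r !mul0r addr0.
  have -> : h * t + P / 6 = h * (t + 1) by rewrite mulrDr mulr1.
  by rewrite /sqnorm !mxE => E; rewrite expr_div_n -E /X /Y; field.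
have bd t : boundary K (gamma t) by rewrite -range_gamma; exists t.
have neq a b : a < b -> b < a + 6 -> gamma (h * a) != gamma (h * b).
  move=> ab ba; apply/eqP; apply: (periodic_injective P0 per inj).
    by rewrite ltr_pM2l.
  by rewrite -h6 -mulrDr ltr_pM2l.
have D0 a b c : a < b -> b < c -> c < a + 6 ->
    det ((X b, Y b) - (X a, Y a)) ((X c, Y c) - (X a, Y a)) != 0.
  move=> ab bc ca.
  have := boundary_noncollinear clK strictK (bd (h * a)) (bd (h * b)) (bd (h * c)).
  move=> /(_ (neq _ _ ab (lt_trans bc ca)) (neq _ _ bc _) (neq _ _ (lt_trans ab bc) ca)).
  have cb : c < b + 6 by lra.
  move=> /(_ cb) D0; rewrite -(mulrI_eq0 _ (mulfI (expf_neq0 2 hn0))) /det /X /Y /=.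
  by apply: contra_neq D0 => <-; field.
have [c1 [c2 circ]] : exists c1 c2, forall t,
    (X t - c1) ^+ 2 + (Y t - c2) ^+ 2 = (l / h) ^+ 2.
  have lh : 0 < l / h by rewrite divr_gt0.
  have [pos|neg] := orientation_const dX dY D0.
    exact: (equilateral_hexagon_circle dX dY X6 Y6 UV pos lh sideXY).
  (* Exchanging the coordinates reverses the orientation. *)
  have pos a b c : a < b -> b < c -> c < a + 6 ->
      0 < det ((Y b, X b) - (Y a, X a)) ((Y c, X c) - (Y a, X a)).
    move=> ab bc ca; rewrite -oppr_lt0; apply: le_lt_trans (neg a b c ab bc ca).
    by rewrite /det /= le_eqVlt; apply/orP; left; apply/eqP; ring.
  have VU t : V t ^+ 2 + U t ^+ 2 = 1 by rewrite addrC.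
  have sideYX t : (Y (t + 1) - Y t) ^+ 2 + (X (t + 1) - X t) ^+ 2 = (l / h) ^+ 2.
    by rewrite addrC.
  have [c2 [c1 circ]] := equilateral_hexagon_circle dY dX Y6 X6 VU pos lh sideYX.
  by exists c1; exists c2 => t; rewrite addrC.
apply: (@is_disk_of_boundary _ K
  (\row_(i < 2) (h * (if i == 0 then c1 else c2))) l) => //.
move=> x; rewrite -range_gamma => -[t _ <-].
have := circ (t / h); rewrite /X /Y [h * _]mulrC divfK// expr_div_n => E.
rewrite -[RHS](mulfVK (expf_neq0 2 hn0)) -E /sqnorm !mxE /=.
by field.
Qed.
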